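(* Let $1<p\leq q<+\infty$, let $\nu$ be a Borel measure on $\mathbb{R}$, and let $S(x)=\nu((-\infty,x])$ for $x\in\mathbb{R}$. Let $\widetilde{\nu}$ be the Borel measure on $\mathbb{R}$ defined by $$\widetilde{\nu}((x,+\infty))=S(x)^{-q/p^*}\qquad\text{for all }x\in\mathbb{R}.$$ If $S(+\infty)=+\infty$, then for any non-negative real measurable function $f$ on $\mathbb{R}$, $$\left[\int_{\mathbb{R}}\left(\int_{(-\infty,x)}f(y)\,\nu(dy)\right)^q\widetilde{\nu}(dx)\right]^{1/q}\leq k_{q,p}\left[\int_{\mathbb{R}}f(y)^p\,\nu(dy)\right]^{1/p}.$$
   Context: Here $p^*=p/(p-1)$ and $S(+\infty)=\lim_{x\to+\infty}S(x)$. Conventions: $0^{-q/p^*}=+\infty$, $(+\infty)^{-q/p^*}=0$, and $0\cdot\infty=0$ in integrals. The constant $k_{q,p}$ is defined for $1<p<q<+\infty$ by $$k_{q,p}=\left(\frac{r}{\mathrm{B}(1/r,(q-1)/r)}\right)^{1/p-1/q},\qquad r=\frac{q}{p}-1,\qquad \mathrm{B}(a,b)=\int_0^1x^{a-1}(1-x)^{b-1}\,dx,$$ and for $p=q$ by $k_{p,p}=p^{1/p}(p^* )^{1/p^*}$. *)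

(* Defs.v *)
From HB Require Import structures.
From mathcomp Require Export all_boot all_order all_algebra.
From mathcomp Require Export all_classical all_reals all_analysis.
Export Order.TTheory GRing.Theory Num.Theory.
Export numFieldNormedType.Exports.

Set Implicit Arguments.
Unset Strict Implicit.
Unset Printing Implicit Defensive.

Local Open Scope classical_set_scope.
Local Open Scope ring_scope.

Definition conj_exp (R : realType) (p : R) : R := p / (p - 1).

(* The library's [beta_fun] only takes natural-number arguments. The open
   interval keeps the integrand away from negative powers of 0. *)
Definition Beta (R : realType) (a b : R) : R :=
  (\int[@lebesgue_measure R]_(x in `]0%R, 1%R[)
     (x `^ (a - 1) * (1 - x) `^ (b - 1)))%R.

Definition kconst (R : realType) (q p : R) : R :=
  if p == q then p `^ (p^-1) * conj_exp p `^ ((conj_exp p)^-1)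
  else let r := q / p - 1 in
       (r / Beta (r^-1) ((q - 1) / r)) `^ (p^-1 - q^-1).

(* Measures on [measurableTypeR R] are the Borel measures on the real line;
   no finiteness is assumed, so [distr nu x] may be +oo. *)
Definition distr (R : realType) (nu : {measure set (measurableTypeR R) -> \bar R})
  (x : R) : \bar R := nu [set` `]-oo, x]%R].

(* [x `^ s] with [s < 0] is 0 at [x = 0] and +oo at [x = +oo] in the library.
   Inverting the positive power gives 0^(-s) = +oo and (+oo)^(-s) = 0, since
   [inve] sends 0 to +oo and +oo to 0. *)
Definition neg_power (R : realType) (x : \bar R) (s : R) : \bar R :=
  ((x `^ s)^-1)%E.

(* Main.v *)
Require Import Defs.
From mathcomp Require Import all_boot all_order all_algebra.
From mathcomp Require Import all_classical all_reals all_analysis.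
From mathcomp Require Import measurable_realfun.
From mathcomp Require Import ring lra.

(**
Write [S] for the distribution function, [m = q / p^*], and use the mass
[s = S x] as the variable in place of [x].  Then [nut] becomes the measure
[m s^(-m-1) ds], the inner integral becomes a nondecreasing function [F s]
with [F 0 = 0], and the inequality becomes Bliss' inequality
  int_0^oo F^q m s^(-m-1) ds <= k^q (int_0^oo (F')^p ds)^(q/p).

The substitution is never performed on the measures.  On a finite grid
[x_0 <= x_1 <= ...], the step function equal to [int_(]-oo, x_i]) f dnu] on
[ ]x_i, x_(i+1)] ] has a [nut]-integral that only involves the numbers [S x_i],
and it lies below the piecewise linear path through the points
[(S x_i, int_(]-oo, x_i]) f dnu)]; by Hoelder's inequality the energy
[int (F')^p] of that path is at most [int f^p dnu] ([hoelder_set],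
[nested_bliss]).  So Bliss' inequality for piecewise linear paths
([discrete_bliss]) bounds these step functions uniformly, and Fatou's lemma
along finer and finer grids gives the theorem ([bliss_power]).  The points with
infinite mass strictly to their left, which the grids do not reach, form a
[nut]-null set ([good_ae]).

For [p < q] put [r = q/p - 1], [n = q/r], [D x = 1 + x^r].  The extremals of
Bliss' inequality are the multiples and dilations of [x (1 + x^r)^(-1/r)].
The proof is the one-dimensional mass transport proof, written as a
verification argument.  Along a path [F], let [x s] be the point up to which
the extremal has accumulated the same left-hand side as [F] has up to [s]
([ex_matching_parameter]).  The function [bellman s F x] then grows along the
path at a rate at most [(F')^p]: this is [certificate_slope], which combines
Young's inequality for [F'] with the arithmetic-geometric inequality between
[x'/x] and [1/s], both being equalities on the extremal.  Integrating over the
path ([path_certificate]) and letting [x] run from 0 to [+oo] compares the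
energy of [F] with that of the extremal, an integral that the substitution
[w = x^r / (1 + x^r)] turns into the Beta function of the constant
([ex_extremal_energy]).  Because the extremal has fixed size, the path is first
rescaled ([path_bound_shift]).

For [p = q] there is no extremal, and the constant of Hardy's inequality comes
from a single application of Young's inequality ([hardy_segment]).
*)

Set Implicit Arguments.
Unset Strict Implicit.
Unset Printing Implicit Defensive.

Local Open Scope classical_set_scope.
Local Open Scope ring_scope.

(** * Real powers, Young's inequality and antiderivatives *)

Section calculus.
Context {R : realType}.
Implicit Types (p c g u v t x y : R) (h dh : R -> R).

Lemma ger_is_derive_le0 h dh (a b : R) : a <= b ->
  (forall s, a <= s <= b -> is_derive s 1 h (dh s)) ->
  (forall s, a <= s <= b -> dh s <= 0) -> h b <= h a.
Proof.
move=> ab hd dh0.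
have [||c cab] := @MVT_segment _ h dh a b ab.
- by move=> x; rewrite in_itv/= => /andP[ax xb]; apply: hd; rewrite !ltW.
- apply: derivable_within_continuous => x; rewrite in_itv/= => xab.
  by have [] := hd _ xab.
rewrite -(subr_le0 (h a)) => ->; rewrite mulr_le0_ge0 ?subr_ge0//; apply: dh0.
by rewrite in_itv/= in cab.
Qed.

Lemma powR_expln x (a : R) : 0 < x -> x `^ a = expR (a * ln x).
Proof. by move=> x0; rewrite /powR gt_eqF. Qed.

Lemma ler_powR2r (a b x : R) : 0 <= x -> 0 <= a -> a <= b -> a `^ x <= b `^ x.
Proof.
move=> x0 a0 ab; apply: ge0_ler_powR => //; rewrite nnegrE//.
exact: le_trans ab.
Qed.

Lemma powRV x (a : R) : 0 < x -> x^-1 `^ a = (x `^ a)^-1.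
Proof. by move=> x0; rewrite -powR_inv1 ?(ltW x0)// -powRrM mulN1r powRN. Qed.

Lemma powRB1 x (a : R) : 0 < x -> x `^ (a - 1) = x `^ a / x.
Proof.
move=> x0; rewrite powRD ?powR_inv1 ?(ltW x0)//.
by apply/implyP => _; rewrite gt_eqF.
Qed.

(** The convex function [g^p] lies above its tangent line at [c]. *)
Lemma young_tangent p c g : 1 < p -> 0 <= c -> 0 <= g ->
  p * c `^ (p - 1) * g <= g `^ p + (p - 1) * c `^ p.
Proof.
move=> p1 c0 g0.
have p0 : 0 < p by lra.
have := @conjugate_powR R g (c `^ (p - 1)) p (p / (p - 1)) g0 (powR_ge0 _ _) p0.
rewrite -powRrM (_ : (p - 1) * (p / (p - 1)) = p); last by field; lra.
have d0 : 0 < p / (p - 1) by rewrite divr_gt0//; lra.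
move=> /(_ d0) H.
have : g * c `^ (p - 1) <= g `^ p / p + c `^ p / (p / (p - 1)).
  by apply: H; field; apply/andP; split; lra.
move=> /(ler_wpM2l (ltW p0)).
rewrite mulrDr (_ : p * (g `^ p / p) = g `^ p); last by field; lra.
rewrite (_ : p * (_ / _) = (p - 1) * c `^ p); last by field; apply/andP; split; lra.
by rewrite (mulrC g) mulrA.
Qed.

Lemma weighted_amgm u v t : 0 <= u -> 0 <= v -> 0 < t < 1 ->
  u `^ t * v `^ (1 - t) <= t * u + (1 - t) * v.
Proof.
move=> u0 v0 /andP[t0 t1].
have := @conjugate_powR R (u `^ t) (v `^ (1 - t)) t^-1 (1 - t)^-1
  (powR_ge0 _ _) (powR_ge0 _ _).
rewrite -!powRrM !mulfV ?powRr1//; try lra.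
rewrite !invrK !invr_gt0 t0 subr_gt0 t1 => /(_ erefl erefl).
rewrite addrC subrK => /(_ erefl) /le_trans; apply.
by rewrite addrC (mulrC u) (mulrC v) addrC.
Qed.

End calculus.

Section antiderivative.
Context {R : realType}.

Lemma is_derive_affine (c g a s : R) :
  is_derive s 1 (fun s => c + g * (s - a)) g.
Proof.
have -> : (fun s => c + g * (s - a)) = cst c + g \*: (id - cst a) by [].
by apply: is_derive_eq; rewrite /GRing.scale/= add0r subr0 mulr1.
Qed.

Lemma ex_antiderivative (G : R -> R) (a b : R) : continuous G ->
  exists Z : R -> R, forall s, a <= s <= b -> is_derive s 1 Z (G s).
Proof.
move=> cG; pose mu := @lebesgue_measure R.
exists (fun x => \int[mu]_(t in [set` `[a - 1, x]]) G t) => s /andP[as_ sb].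
have iG : mu.-integrable `[a - 1, b + 1] (EFin \o G).
  apply: continuous_compact_integrable; first exact: segment_compact.
  exact: continuous_subspaceT.
have sb1 : s < b + 1 by lra.
have as1 : a - 1 < s by lra.
have [dF F's] := continuous_FTC1_closed sb1 iG as1 (cG s).
split; [exact: dF | by rewrite -derive1E; exact: F's].
Qed.

Lemma continuous_powR_comp (h : R -> R) (c a x : R) : 0 < c ->
  (forall y, c <= h y) -> {for x, continuous h} ->
  {for x, continuous (fun y => h y `^ a)}.
Proof.
move=> c0 ch hx.
have hx0 : 0 < h x by exact: lt_le_trans (ch x).
apply: (@continuous_comp _ _ _ h (fun y => y `^ a)) => //.
apply: differentiable_continuous; apply/derivable1_diffP.
by have [] := is_derive1_powR a hx0.
Qed.

(** The function to integrate is only controlled on [ [a, b] ]; replacing [s] and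
the affine function by their maxima with [a] and [phi] makes it continuous on
the whole line without changing it there. *)
Lemma ex_tail_antiderivative (m q a b phi g : R) : 0 < a -> 0 < phi -> 0 <= g ->
  exists Z : R -> R, forall s, a <= s <= b ->
    is_derive s 1 Z (m * (s `^ (- (m + 1)) * (phi + g * (s - a)) `^ q)).
Proof.
move=> a0 phi0 g0.
pose G s := m * (Num.max a s `^ (- (m + 1)) *
                 (Num.max phi (phi + g * (s - a))) `^ q).
have [] := @ex_antiderivative G a b.
  move=> x; apply: cvgM; first exact: cvg_cst.
  apply: cvgM.
  - apply: (@continuous_powR_comp (fun s => Num.max a s) a) => [//|y|].
      by rewrite le_max lexx.
    by apply: continuous_max; [exact: cvg_cst | exact: cvg_id].
  - apply: (@continuous_powR_comp
      (fun s => Num.max phi (phi + g * (s - a))) phi) => [//|y|].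
      by rewrite le_max lexx.
    apply: continuous_max; first exact: cvg_cst.
    apply: cvgD; first exact: cvg_cst.
    apply: cvgM; first exact: cvg_cst.
    by apply: cvgB; [exact: cvg_id | exact: cvg_cst].
move=> Z HZ; exists Z => s asb; have /andP[sa _] := asb.
have := HZ s asb; rewrite /G !max_r//.
by rewrite lerDl mulr_ge0// subr_ge0.
Qed.

(** By strict convexity a straight segment is the cheapest way to go from
[(a, phi)] to [(b, psi)]: if [dE] satisfies Hoelder's bound, it pays for the
segment, even when [a = b]. *)
Lemma secant_slope (p a b phi psi dE : R) : 1 < p -> a <= b -> phi <= psi ->
  0 <= dE -> (psi - phi) `^ p <= dE * (b - a) `^ (p - 1) ->
  let g := (psi - phi) / (b - a) in
  [/\ 0 <= g, phi + g * (b - a) = psi & g `^ p * (b - a) <= dE].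
Proof.
move=> p1 ab pp dE0 H g.
have g0 : 0 <= g by rewrite divr_ge0// subr_ge0.
move: ab; rewrite le_eqVlt => /predU1P[ab|ab].
  rewrite /g ab subrr !mulr0 addr0; split=> //; rewrite ?invr0 ?mulr0//.
  move: H; rewrite ab subrr powR0 ?mulr0; last by rewrite gt_eqF// subr_gt0.
  move=> H; have : (psi - phi) `^ p = 0 by apply/eqP; rewrite eq_le H powR_ge0.
  by move/powR_eq0_eq0/eqP; rewrite subr_eq0 => /eqP.
have ba : 0 < b - a by rewrite subr_gt0.
have gE : g * (b - a) = psi - phi by rewrite /g divfK// gt_eqF.
split=> //; first by rewrite gE addrC subrK.
rewrite -(ler_pM2r (powR_gt0 (p - 1) ba)); apply: le_trans H.
rewrite -gE powRM ?(ltW ba)// -mulrA mulr_powRB1 ?(ltW ba)//.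
by rewrite (lt_trans _ p1).
Qed.

End antiderivative.

Section powR_limits.
Context {R : realType}.

Lemma powRN_cvgy (a : R) : 0 < a -> x `^ (- a) @[x --> +oo] --> (0 : R).
Proof.
move=> a0; apply/cvgrPdist_lt => eps eps0.
near=> x.
have x0 : 0 < x by near: x; exact: nbhs_pinfty_gt.
rewrite sub0r normrN ger0_norm ?powR_ge0// powRN -[ltRHS]invrK.
rewrite ltf_pV2 ?posrE ?powR_gt0 ?invr_gt0//.
have -> : eps^-1 = (eps^-1 `^ a^-1) `^ a.
  by rewrite -powRrM mulVf ?gt_eqF// powRr1// invr_ge0 ltW.
rewrite gt0_ltr_powR ?nnegrE ?powR_ge0 ?(ltW x0)//.
Unshelve. all: by end_near. Qed.

Lemma powR_cvg (T : Type) (F : set_system T) (FF : Filter F) (f : T -> R) (l a : R) :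
  0 < l -> f x @[x --> F] --> l -> (f x) `^ a @[x --> F] --> l `^ a.
Proof.
move=> l0 fl.
have c : {for l, continuous (fun y : R => y `^ a)}.
  apply: differentiable_continuous; apply/derivable1_diffP.
  by have [] := is_derive1_powR a l0.
exact: (cvg_comp _ _ fl c).
Qed.

Lemma invx_cvgy : x^-1 @[x --> +oo] --> (0 : R).
Proof.
apply/cvgrPdist_lt => eps eps0; near=> x.
have x0 : 0 < x by near: x; exact: nbhs_pinfty_gt.
rewrite sub0r normrN ger0_norm ?invr_ge0 ?(ltW x0)// -[ltRHS]invrK.
rewrite ltf_pV2 ?posrE ?invr_gt0//.
by near: x; apply: nbhs_pinfty_gt; exact: num_real.
Unshelve. all: by end_near. Qed.

End powR_limits.

(** * Bliss' inequality for piecewise linear paths, p < q *)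

Section extremal.
Context {R : realType}.
Variables (p q : R).
Hypotheses (hp : 1 < p) (hpq : p < q).
Let r := q / p - 1.
Let m := q - q / p.
Let n := q / r.
Variable e : R -> R.
Let D (x : R) := 1 + x `^ r.
Hypothesis e_derive : forall x : R, 0 < x -> is_derive x 1 e (D x `^ (- n)).

Let p_gt0 : 0 < p. Proof. by move: hp; lra. Qed.
Let q_gt0 : 0 < q. Proof. by move: hp hpq; lra. Qed.
Let r_gt0 : 0 < r. Proof. by rewrite /r subr_gt0 ltr_pdivlMr ?mul1r. Qed.
Let m_gt0 : 0 < m.
Proof. by rewrite /m subr_gt0 ltr_pdivrMr// ltr_pMr. Qed.
Let D_gt0 x : 0 < D x. Proof. by rewrite /D ltr_wpDr// powR_ge0. Qed.
Let rn : r * n = q. Proof. by rewrite /n mulrC divfK// gt_eqF. Qed.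

(** The differential form of the inequality.  The left-hand side is the
derivative of [bellman] along a path of slope [g], where [x'] is the speed of
the matched parameter and [theta = d^(-n) x'] the rate at which the extremal
spends energy, [d] standing for [D x].  Young's inequality is applied at the
slope [theta^(1/p)], so that [kappa F^m = theta^((p-1)/p)]; the weights [r/q]
and [(m+1)/q] of the arithmetic-geometric inequality are the ones for which the
geometric mean of [x'/x] and [1/s] times [kappa F^(m+1)] is exactly [theta d]. *)
Lemma certificate_slope (s F x g d kappa x' theta : R) :
  0 < s -> 0 < F -> 0 < x -> 0 <= g -> 0 < d ->
  kappa = x `^ (- (r * (p - 1) / p)) * s `^ (- ((m + 1) * (p - 1) / p)) ->
  x' = s `^ (- (m + 1)) * F `^ q * x `^ (- r) * d `^ n ->
  theta = d `^ (- n) * x' ->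
  theta + p * kappa * F `^ m * g - p * theta + p * m / (m + 1) * (d * theta)
    - (p - 1) / (m + 1) * (kappa * F `^ (m + 1) * (r * (x' / x) + (m + 1) / s))
  <= g `^ p.
Proof.
move=> s0 F0 x0 g0 d0 kappaE x'E thetaE.
have th0 : 0 <= theta by rewrite ?thetaE ?x'E !mulr_ge0 ?powR_ge0.
have pn0 : p != 0 by rewrite gt_eqF.
have qn0 : q != 0 by rewrite gt_eqF.
have rn0 : r != 0 by rewrite gt_eqF.
have qpn0 : q - p != 0 by rewrite subr_eq0 gt_eqF.
have thE : theta = expR (- (m + 1) * ln s + q * ln F - r * ln x).
  rewrite ?thetaE ?x'E !powR_expln// -!expRD; congr expR; lra.
have kFE : kappa * F `^ m = (theta `^ p^-1) `^ (p - 1).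
  rewrite -powRrM thE kappaE !powR_expln ?expR_gt0// expRK -!expRD.
  by congr expR; rewrite /m /r; field.
have thp : (theta `^ p^-1) `^ p = theta by rewrite -powRrM mulVf// powRr1.
have := young_tangent hp (powR_ge0 theta p^-1) g0.
rewrite -kFE thp => young.
have t01 : 0 < r / q < 1.
  rewrite divr_gt0//= ltr_pdivrMr// mul1r /r.
  by move: m_gt0; rewrite /m; lra.
have x'0 : 0 < x' by rewrite x'E !mulr_gt0// powR_gt0.
have s'0 : 0 <= s^-1 by rewrite invr_ge0 ltW.
have := weighted_amgm (ltW (divr_gt0 x'0 x0)) s'0 t01.
rewrite (_ : 1 - r / q = (m + 1) / q); last by rewrite /m /r; field; apply/andP.
move=> am.
have kF0 : 0 <= kappa * F `^ (m + 1) by rewrite kappaE !mulr_ge0 ?powR_ge0.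
have {am} := ler_wpM2l kF0 am.
have -> : kappa * F `^ (m + 1) * ((x' / x) `^ (r / q) * s^-1 `^ ((m + 1) / q)) =
    theta * d.
  rewrite thE.
  have -> : d = expR (ln d) by rewrite lnK.
  have -> : x' / x = expR (- (m + 1) * ln s + q * ln F - (r + 1) * ln x + n * ln d).
    rewrite x'E -[X in _ / X](@lnK _ x)// !powR_expln// -expRN -!expRD.
    by congr expR; rewrite /n; lra.
  have -> : s^-1 = expR (- ln s) by rewrite expRN lnK.
  rewrite kappaE !powR_expln ?expR_gt0// !expRK -!expRD.
  congr expR; rewrite /n /m /r; field.
  by rewrite pn0 qn0/= mulN1r.
move=> am.
have w0 : 0 < (p - 1) * q / (m + 1).
  rewrite divr_gt0 ?(addr_gt0 m_gt0)// mulr_gt0// subr_gt0//.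
have {am} := ler_wpM2l (ltW w0) am.
have mE : (p - 1) * q = p * m by rewrite /m; field.
rewrite mE => am.
have -> : (p - 1) / (m + 1) * (kappa * F `^ (m + 1) * (r * (x' / x) + (m + 1) / s)) =
   p * m / (m + 1) * (kappa * F `^ (m + 1) * (r / q * (x' / x) + (m + 1) / q / s)).
  rewrite -mE; move: (m + 1) (addr_gt0 m_gt0 (@ltr01 R)) => M M0.
  by field; rewrite qn0 !gt_eqF.
move: young am; rewrite -(mulrA p kappa) (mulrC d theta).
move: (p * (kappa * F `^ m) * g) (_ * (theta * d)) (_ * (_ * (_ + _))) => A B C; lra.
Qed.

(** [int_0^x F^q m t^(-m-1) dt] for the extremal [F t = t (1 + t^r)^(-1/r)], when
[e] is its energy [int_0^x (F')^p dt = int_0^x (1 + t^r)^(-n) dt]. *)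
Definition extremal_gain x := e x - x * D x `^ (1 - n).
(** The value of [bellman] at [F = 0]; it tends to the total energy of the
extremal at [+oo]. *)
Definition bellman0 x := e x - p / (m + 1) * (x * D x `^ (1 - n)).
(** On the extremal itself, [s = x] and [F = x (1 + x^r)^(-1/r)], the correction
terms cancel and this is the energy [e x]. *)
Definition bellman s F x := bellman0 x +
  p / (m + 1) * (x `^ (- (r * (p - 1) / p)) * s `^ (- ((m + 1) * (p - 1) / p)) *
                 F `^ (m + 1)).

Lemma is_derive_mul_powR_D (x : R) : 0 < x ->
  is_derive x 1 (fun x => x * D x `^ (1 - n))
   (D x `^ (- n) * ((m + 1) - m * D x)).
Proof.
move=> x0.
have dx := is_derive1_powR r x0.
have dD : is_derive x 1 D (r * x `^ (r - 1)).
  have -> : D = cst 1 + (fun y => y `^ r) by [].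
  by apply: is_derive_eq; rewrite add0r.
have dP := is_derive1_powR (1 - n) (D_gt0 x).
have dC : is_derive x 1 (fun x => D x `^ (1 - n))
    ((1 - n) * D x `^ (1 - n - 1) * (r * x `^ (r - 1))).
  exact: (@is_derive1_comp _ (fun y => y `^ (1 - n)) D).
have -> : (fun x => x * D x `^ (1 - n)) = id * (fun x => D x `^ (1 - n)) by [].
apply: is_derive_eq.
rewrite /= /GRing.scale/= mulr1.
have -> : 1 - n - 1 = - n by lra.
have -> : D x `^ (1 - n) = D x * D x `^ (- n).
  by rewrite powRD ?powRr1 ?(ltW (D_gt0 x))// (gt_eqF (D_gt0 x)) implybT.
rewrite (_ : x * ((1 - n) * D x `^ (- n) * (r * x `^ (r - 1))) =
  (r - r * n) * (x * x `^ (r - 1)) * D x `^ (- n)); last by ring.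
rewrite mulr_powRB1 ?(ltW x0)// rn.
have -> : x `^ r = D x - 1 by rewrite /D; lra.
have -> : r - q = - (m + 1) by rewrite /r /m; lra.
by ring.
Qed.

Lemma is_derive_extremal_gain (x : R) : 0 < x ->
  is_derive x 1 extremal_gain (m * (x `^ r * D x `^ (- n))).
Proof.
move=> x0; have d1 := is_derive_mul_powR_D x0; have d2 := e_derive x0.
have -> : extremal_gain = e - (fun x => x * D x `^ (1 - n)) by [].
apply: is_derive_eq.
have -> : x `^ r = D x - 1 by rewrite /D; lra.
by ring.
Qed.

Lemma is_derive_bellman0 (x : R) : 0 < x ->
  is_derive x 1 bellman0 (D x `^ (- n) * (1 - p + p * m / (m + 1) * D x)).
Proof.
move=> x0; have d1 := is_derive_mul_powR_D x0; have d2 := e_derive x0.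
have -> : bellman0 = e - (p / (m + 1)) \*: (fun x => x * D x `^ (1 - n)) by [].
apply: is_derive_eq.
rewrite /GRing.scale/=; move: (m) (addr_gt0 m_gt0 (@ltr01 R)) => M M0.
by field; rewrite gt_eqF.
Qed.

Opaque extremal_gain bellman0.

Lemma extremal_gain_lt a b : 0 < a -> a < b -> extremal_gain a < extremal_gain b.
Proof.
move=> a0 ab.
have dz x : x \in `]a, b[ -> is_derive x 1 extremal_gain (m * (x `^ r * D x `^ (- n))).
  by rewrite in_itv/= => /andP[ax _]; apply: is_derive_extremal_gain; exact: lt_trans ax.
have [|c + E] := MVT ab dz.
  apply: derivable_within_continuous => x; rewrite in_itv/= => /andP[ax _].
  by have [] := is_derive_extremal_gain (lt_le_trans a0 ax).
rewrite in_itv/= => /andP[ac _].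
have c0 : 0 < c by exact: lt_trans ac.
have ba0 : 0 < b - a by rewrite subr_gt0.
by rewrite -subr_gt0 E !mulr_gt0 ?powR_gt0.
Qed.

Definition extremal_gain_inv w := xget 1 [set x | 0 < x /\ extremal_gain x = w].

Lemma extremal_gainK x : 0 < x -> extremal_gain_inv (extremal_gain x) = x.
Proof.
move=> x0; rewrite /extremal_gain_inv; case: xgetP => [y _ [y0 yx]|/(_ x)]; last first.
  by move=> H; exfalso; apply: H.
have A := @extremal_gain_lt y x y0; have B := @extremal_gain_lt x y x0; rewrite yx in A B.
by case: (ltgtP x y) => [/B|/A|//]; rewrite ltxx.
Qed.

Lemma is_derive_extremal_gain_inv (x : R) : 0 < x ->
  is_derive (extremal_gain x) 1 extremal_gain_inv (m * (x `^ r * D x `^ (- n)))^-1.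
Proof.
move=> x0; apply: (@is_derive_inverse _ extremal_gain).
- by near=> y; apply: extremal_gainK; near: y; exact: lt_nbhsr.
- near=> y; apply: differentiable_continuous; apply/derivable1_diffP.
  have y0 : 0 < y by near: y; exact: lt_nbhsr.
  by have [] := is_derive_extremal_gain y0.
- exact: is_derive_extremal_gain.
- by rewrite !mulf_neq0 ?gt_eqF// powR_gt0.
Unshelve. all: by end_near. Qed.

Lemma extremal_gain_le_inv a b : 0 < a -> 0 < b ->
  extremal_gain a <= extremal_gain b -> a <= b.
Proof.
move=> a0 b0 zab; rewrite leNgt; apply/negP => ba.
by have := extremal_gain_lt b0 ba; rewrite ltNge zab.
Qed.

Lemma extremal_gain_IVT xa X w : 0 < xa -> 0 < X ->
  extremal_gain xa <= w -> w <= extremal_gain X ->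
  exists2 x, 0 < x & extremal_gain x = w.
Proof.
move=> xa0 X0 w1 w2.
have aX : xa <= X by exact: extremal_gain_le_inv xa0 X0 (le_trans w1 w2).
have [||c] := @IVT _ extremal_gain xa X w aX.
- apply: derivable_within_continuous => x; rewrite in_itv/= => /andP[ax _].
  by have [] := is_derive_extremal_gain (lt_le_trans xa0 ax).
- by rewrite (min_l (le_trans w1 w2)) (max_r (le_trans w1 w2)) w1 w2.
- rewrite in_itv/= => /andP[ac _] cw; exists c => //; exact: lt_le_trans ac.
Qed.

Lemma extremal_gain_inj a b : 0 < a -> 0 < b ->
  extremal_gain a = extremal_gain b -> a = b.
Proof. by move=> a0 b0 ab; rewrite -(extremal_gainK a0) ab (extremal_gainK b0). Qed.

(** [Z] measures what the path has gained; [x s] is where the extremal has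
gained the same.  The bound by [extremal_gain X] keeps the equation solvable,
as the total gain of the extremal is finite. *)
Lemma ex_matching_parameter (a b xa X : R) (Z G : R -> R) :
  a <= b -> 0 < xa -> 0 < X ->
  (forall s, a <= s <= b -> is_derive s 1 Z (m * G s)) ->
  (forall s, a <= s <= b -> 0 <= G s) ->
  extremal_gain xa + (Z b - Z a) <= extremal_gain X ->
  exists x : R -> R, forall s, a <= s <= b ->
    [/\ 0 < x s, extremal_gain (x s) = extremal_gain xa + (Z s - Z a) &
     is_derive s 1 x (G s * x s `^ (- r) * D (x s) `^ n)].
Proof.
move=> ab xa0 X0 dZ G0 ZX.
have Zmono s t : a <= s -> s <= t -> t <= b -> Z s <= Z t.
  move=> as_ st tb.
  rewrite -lerN2; apply: (@ger_is_derive_le0 _ (- Z) (fun s => - (m * G s)) s t st).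
  - move=> u /andP[su ut]; apply: is_deriveN; apply: dZ.
    by rewrite (le_trans as_ su) (le_trans ut tb).
  - move=> u /andP[su ut]; rewrite oppr_le0 mulr_ge0 ?(ltW m_gt0)//; apply: G0.
    by rewrite (le_trans as_ su) (le_trans ut tb).
exists (fun s => extremal_gain_inv (extremal_gain xa + (Z s - Z a))) => s asb.
have [as_ sb] := andP asb.
have [||y y0 yw] := @extremal_gain_IVT xa X (extremal_gain xa + (Z s - Z a)) xa0 X0.
- by rewrite lerDl subr_ge0 Zmono.
- by apply: le_trans ZX; rewrite lerD2l lerD2r Zmono.
have xsy : extremal_gain_inv (extremal_gain xa + (Z s - Z a)) = y.
  by rewrite -yw; exact: extremal_gainK.
rewrite xsy; split=> //.
have d1 := dZ _ asb.
have dw : is_derive s 1 (fun s => extremal_gain xa + (Z s - Z a)) (m * G s).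
  have -> : (fun s => extremal_gain xa + (Z s - Z a)) = cst (extremal_gain xa) + (Z - cst (Z a)).
    by [].
  apply: (is_derive_eq (is_deriveD (is_derive_cst _ _ _)
    (is_deriveB d1 (is_derive_cst _ _ _)))).
  by rewrite subr0 add0r.
have di := is_derive_extremal_gain_inv y0; rewrite yw in di.
rewrite (_ : G s * _ * _ = (m * (y `^ r * D y `^ (- n)))^-1 * (m * G s)).
  exact: (@is_derive1_comp _ extremal_gain_inv (fun s => extremal_gain xa + (Z s - Z a))).
rewrite (powRN y) (powRN (D y)).
have yr : 0 < y `^ r by rewrite powR_gt0.
have Dn : 0 < D y `^ n by rewrite powR_gt0.
move: (y `^ r) (D y `^ n) yr Dn (m) m_gt0 => A B A0 B0 M M0.
by field; rewrite !gt_eqF.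
Qed.

(** [certificate_slope] integrated over one linear piece of the path. *)
Lemma segment_certificate (a b phi g xa X : R) (Z : R -> R) :
  0 < a -> a <= b -> 0 < phi -> 0 <= g -> 0 < xa -> 0 < X ->
  (forall s, a <= s <= b -> is_derive s 1 Z
     (m * (s `^ (- (m + 1)) * (phi + g * (s - a)) `^ q))) ->
  extremal_gain xa + (Z b - Z a) <= extremal_gain X ->
  exists xb, [/\ 0 < xb, extremal_gain xb = extremal_gain xa + (Z b - Z a) &
    bellman b (phi + g * (b - a)) xb - bellman a phi xa <= g `^ p * (b - a)].
Proof.
move=> a0 ab phi0 g0 xa0 X0 dZ ZX.
have F0 s : a <= s -> 0 < phi + g * (s - a).
  by move=> as_; rewrite ltr_wpDr// mulr_ge0// subr_ge0.
have [|x xP] := @ex_matching_parameter a b xa X Z _ ab xa0 X0 dZ _ ZX.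
  by move=> s _; rewrite mulr_ge0 ?powR_ge0.
have bb : a <= b <= b by rewrite ab lexx.
have aa : a <= a <= b by rewrite ab lexx.
have xaE : x a = xa.
  have [x0 xz _] := xP _ aa; rewrite subrr addr0 in xz.
  exact: (extremal_gain_inj x0 xa0 xz).
have [xb0 xbz _] := xP _ bb.
exists (x b); split; [exact: xb0|exact: xbz|].
pose F s := phi + g * (s - a).
pose x' s := s `^ (- (m + 1)) * F s `^ q * x s `^ (- r) * D (x s) `^ n.
pose kap s := x s `^ (- (r * (p - 1) / p)) * s `^ (- ((m + 1) * (p - 1) / p)).
pose h s := bellman s (F s) (x s) - g `^ p * (s - a).
suff : h b <= h a.
  rewrite /h /F xaE !subrr !mulr0 addr0 subr0.
  by rewrite lerBlDr => H; rewrite lerBlDr [leRHS]addrC.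
have dF (s : R) : is_derive s 1 F g.
  exact: is_derive_affine.
apply: (@ger_is_derive_le0 _ h (fun s =>
  D (x s) `^ (- n) * (1 - p + p * m / (m + 1) * D (x s)) * x' s +
  p / (m + 1) *
   ((m + 1) * kap s * F s `^ m * g
   - (p - 1) / p * (kap s * F s `^ (m + 1) * (r * (x' s / x s) + (m + 1) / s)))
  - g `^ p) _ _ ab).
- move=> s asb; have [xs0 zxs dxs] := xP _ asb.
  have s0 : 0 < s by case/andP: asb => as_ _; exact: lt_le_trans as_.
  have Fs0 : 0 < F s by apply: F0; case/andP: asb.
  have dy := is_derive_bellman0 xs0.
  set rho := - (r * (p - 1) / p).
  set sig := - ((m + 1) * (p - 1) / p).
  have d1 := is_derive1_comp (is_derive1_powR rho xs0) dxs.
  have d2 := is_derive1_powR sig s0.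
  have d3 := is_derive1_comp (is_derive1_powR (m + 1) Fs0) (dF s).
  have d4 := is_derive1_comp dy dxs.
  have d5 : is_derive s 1 (fun s => g `^ p * (s - a)) (g `^ p).
    have := is_derive_affine 0 (g `^ p) a s.
    by under eq_fun do rewrite add0r.
  have d6 := is_deriveZ (p / (m + 1)) (is_deriveM (is_deriveM d1 d2) d3).
  apply: (is_derive_eq (is_deriveB (is_deriveD d4 d6) d5)).
  rewrite /GRing.scale /= !(powRB1 _ xs0) (powRB1 _ s0) (powRB1 _ Fs0) -/rho -/sig.
  rewrite -/(F s) -/(x' s) /kap -/rho -/sig.
  rewrite (_ : (_ * _) s = x s `^ rho * s `^ sig); last by [].
  have -> : F s `^ (m + 1) = F s `^ m * F s.
    by rewrite -[X in _ * X](powRr1 (ltW Fs0)) -powRD// (gt_eqF Fs0) implybT.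
  have pn0 : p != 0 by rewrite gt_eqF.
  have sn0 : s != 0 by rewrite gt_eqF.
  have xn0 : x s != 0 by rewrite gt_eqF.
  have Fn0 : F s != 0 by rewrite gt_eqF.
  have mn0 : m + 1 != 0 by rewrite gt_eqF// addr_gt0.
  have -> : rho = - (r * (p - 1) / p) by [].
  have -> : sig = - ((m + 1) * (p - 1) / p) by [].
  clear - pn0 sn0 xn0 Fn0 mn0.
  move: (x s) (F s) xn0 Fn0 (D (x s) `^ (- n)) (D (x s)) (x' s) (s `^ _)
    (x s `^ _) (F s `^ m) (g `^ p) => x0 F0 xn0 Fn0 A B C E G H K.
  move: (m + 1) mn0 => M mn0.
  by field; rewrite pn0 sn0 xn0 Fn0 mn0.
- move=> s asb; have [xs0 zxs dxs] := xP _ asb.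
  have s0 : 0 < s by case/andP: asb => as_ _; exact: lt_le_trans as_.
  have Fs0 : 0 < F s by apply: F0; case/andP: asb.
  have := @certificate_slope s (F s) (x s) g (D (x s)) (kap s)
    (x' s) (D (x s) `^ (- n) * x' s) s0 Fs0 xs0 g0 (D_gt0 _) erefl erefl erefl.
  rewrite -subr_le0; apply: le_trans.
  rewrite le_eqVlt; apply/orP; left; apply/eqP.
  have pn0 : p != 0 by rewrite gt_eqF.
  have mn0 : m + 1 != 0 by rewrite gt_eqF// addr_gt0.
  clear - pn0 mn0.
  move: (x s) (D (x s) `^ (- n)) (D (x s)) (x' s) (kap s) (F s `^ m) (F s `^ (m + 1)) (g `^ p)
     => G A B C E H K J.
  move: (r * (C / G) + (m + 1) / s) => L.
  move: (m + 1) mn0 => M mn0.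
  by field; rewrite mn0 pn0.
Qed.
(** Replacing the increasing path by its initial value on the segment only
decreases the gain; this is the step function seen on a grid. *)
Lemma segment_lower (a b phi g : R) (Z : R -> R) :
  0 < a -> a <= b -> 0 < phi -> 0 <= g ->
  (forall s, a <= s <= b -> is_derive s 1 Z
     (m * (s `^ (- (m + 1)) * (phi + g * (s - a)) `^ q))) ->
  phi `^ q * (a `^ (- m) - b `^ (- m)) <= Z b - Z a.
Proof.
move=> a0 ab phi0 g0 dZ.
pose h s := - phi `^ q * s `^ (- m) - Z s.
suff : h b <= h a.
  rewrite /h !mulNr mulrBr.
  move: (phi `^ q * b `^ (- m)) (phi `^ q * a `^ (- m)) (Z a) (Z b) => A B C E.
  lra.
apply: (@ger_is_derive_le0 _ h (fun s => - phi `^ q * (- m * s `^ (- m - 1)) -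
  (m * (s `^ (- (m + 1)) * (phi + g * (s - a)) `^ q))) _ _ ab).
- move=> s asb; have s0 : 0 < s by case/andP: asb => as_ _; exact: lt_le_trans as_.
  exact: (is_deriveB (is_deriveZ _ (is_derive1_powR (- m) s0)) (dZ _ asb)).
- move=> s /andP[as_ sb].
  have -> : - (m + 1) = - m - 1 by exact: opprD.
  rewrite subr_le0; set S := s `^ (- m - 1).
  have -> : - phi `^ q * (- m * S) = m * (S * phi `^ q) by ring.
  rewrite ler_wpM2l ?(ltW m_gt0)// ler_wpM2l ?powR_ge0//.
  have ps : phi <= phi + g * (s - a) by rewrite lerDl mulr_ge0// subr_ge0.
  rewrite ge0_ler_powR ?(ltW q_gt0) ?nnegrE ?(ltW phi0)//.
  exact: le_trans (ltW phi0) ps.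
Qed.

(** The growth of [bellman] adds up over the pieces, and so do the gains: the
final parameter is where the extremal has gained as much as the whole path. *)
Lemma path_certificate (N : nat) (s F E : nat -> R) (Z : nat -> R -> R) x0 X :
  let g i := (F i.+1 - F i) / (s i.+1 - s i) in
  0 < s 0%N -> 0 < F 0%N ->
  (forall i, (i < N)%N -> [/\ s i <= s i.+1, F i <= F i.+1, E i <= E i.+1 &
   (F i.+1 - F i) `^ p <= (E i.+1 - E i) * (s i.+1 - s i) `^ (p - 1)]) ->
  (forall i, (i < N)%N -> forall t, s i <= t <= s i.+1 -> is_derive t 1 (Z i)
    (m * (t `^ (- (m + 1)) * (F i + g i * (t - s i)) `^ q))) ->
  0 < x0 -> 0 < X ->
  extremal_gain x0 + \sum_(0 <= i < N) (Z i (s i.+1) - Z i (s i)) <= extremal_gain X ->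
  exists x, [/\ 0 < x,
    extremal_gain x = extremal_gain x0 + \sum_(0 <= i < N) (Z i (s i.+1) - Z i (s i)) &
    bellman (s N) (F N) x - bellman (s 0%N) (F 0%N) x0 <= E N - E 0%N].
Proof.
move=> g s0 F0 step dZ x00 X0.
have pos i : (i <= N)%N -> 0 < s i /\ 0 < F i.
  elim: i => [//|i IH] iN; have [si Fi] := IH (ltnW iN).
  by have [ss FF _ _] := step i iN; split; [exact: lt_le_trans ss|exact: lt_le_trans FF].
have sl i : (i < N)%N -> [/\ 0 <= g i, F i + g i * (s i.+1 - s i) = F i.+1 &
    g i `^ p * (s i.+1 - s i) <= E i.+1 - E i].
  move=> iN; have [ss FF EE H] := step i iN.
  have dE : 0 <= E i.+1 - E i by rewrite subr_ge0.
  exact: (secant_slope hp ss FF dE H).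
have dZ0 i : (i < N)%N -> 0 <= Z i (s i.+1) - Z i (s i).
  move=> iN; have [ss _ _ _] := step i iN; have [si Fi] := pos i (ltnW iN).
  have [gi _ _] := sl i iN.
  apply: le_trans (segment_lower si ss Fi gi (dZ i iN)).
  rewrite mulr_ge0 ?powR_ge0// subr_ge0 !powRN lef_pV2 ?posrE ?powR_gt0//; last first.
    exact: lt_le_trans ss.
  rewrite ge0_ler_powR ?(ltW m_gt0) ?nnegrE ?(ltW si)//.
  exact: le_trans (ltW si) ss.
suff H k : (k <= N)%N ->
  extremal_gain x0 + \sum_(0 <= i < N) (Z i (s i.+1) - Z i (s i)) <=
    extremal_gain X ->
  exists x, [/\ 0 < x,
    extremal_gain x = extremal_gain x0 + \sum_(0 <= i < k) (Z i (s i.+1) - Z i (s i)) &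
    bellman (s k) (F k) x - bellman (s 0%N) (F 0%N) x0 <= E k - E 0%N].
  by apply: H.
move=> + zX; elim: k => [_|k IH kN].
  by exists x0; rewrite big_geq// addr0 !subrr.
have [x [x_gt0 zx Yx]] := IH (ltnW kN).
have [ss _ _ _] := step k kN; have [sk Fk] := pos k (ltnW kN).
have [gk Fk1 Ek] := sl k kN.
have [|y [y0 zy Yy]] := @segment_certificate (s k) (s k.+1) (F k) (g k) x X (Z k)
    sk ss Fk gk x_gt0 X0 (dZ k kN).
  rewrite zx -addrA.
  rewrite -(big_nat_recr k 0%N (fun i : nat => Z i (s i.+1) - Z i (s i)))//.
  apply: le_trans zX; rewrite lerD2l.
  rewrite [leRHS](big_cat_nat (leq0n k.+1) kN)/= lerDl big_nat_cond sumr_ge0// => i.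
  by rewrite andbT => /andP[_ iN]; exact: dZ0.
exists y; split; [exact: y0 | by rewrite zy zx big_nat_recr// [RHS]addrA |].
rewrite Fk1 in Yy.
rewrite -(subrKA (bellman (s k) (F k) x)) -[leRHS](subrKA (E k)).
exact: lerD (le_trans Yy Ek) Yx.
Qed.

Let m1_gt0 : 0 < m + 1. Proof. by rewrite addr_gt0. Qed.
Let k0 : 0 <= p / (m + 1). Proof. by rewrite divr_ge0// ltW. Qed.

(** The path is raised by [delta] so that it stays positive, where real powers
are differentiable, and scaled by a factor [c] for which its gain equals the
gain of the extremal between [x0] and [X]; the last term bounds the
excess of [bellman] over [bellman0] at the raised starting point. *)
Lemma path_bound_shift (N : nat) (s G E : nat -> R) (delta x0 X W c0 : R) :
  0 < s 0%N -> (forall i, (i <= N)%N -> 0 <= G i) -> E 0%N = 0 -> 0 <= E N ->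
  G 0%N = 0 -> 0 < delta ->
  (forall i, (i < N)%N -> [/\ s i <= s i.+1, G i <= G i.+1, E i <= E i.+1 &
   (G i.+1 - G i) `^ p <= (E i.+1 - E i) * (s i.+1 - s i) `^ (p - 1)]) ->
  0 < x0 -> x0 < X ->
  W = \sum_(0 <= i < N) G i `^ q * (s i `^ (- m) - s i.+1 `^ (- m)) -> 0 < W ->
  c0 = ((extremal_gain X - extremal_gain x0) / W) `^ q^-1 ->
  bellman0 X - bellman0 x0 <= c0 `^ p * E N + p / (m + 1) *
    (x0 `^ (- (r * (p - 1) / p)) * s 0%N `^ (- ((m + 1) * (p - 1) / p)) *
     (c0 * delta) `^ (m + 1)).
Proof.
move=> s0 G0 E0 EN0 G00 d0 step x00 x0X WE W0 c0E.
have X0 : 0 < X by exact: lt_trans x0X.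
have spos i : (i <= N)%N -> 0 < s i.
  elim: i => [//|i IH] iN; have si := IH (ltnW iN).
  by have [ss _ _ _] := step i iN; exact: lt_le_trans si ss.
pose g i := (G i.+1 - G i) / (s i.+1 - s i).
have g0 i : (i < N)%N -> 0 <= g i.
  by move=> iN; have [ss GG _ _] := step i iN; rewrite divr_ge0// subr_ge0.
have Gd i : (i <= N)%N -> 0 < G i + delta.
  by move=> iN; rewrite ltr_wpDl// G0.
have /choice[Z HZ] : forall i, exists Z : R -> R, (i < N)%N ->
    forall t, s i <= t <= s i.+1 -> is_derive t 1 Z
    (m * (t `^ (- (m + 1)) * ((G i + delta) + g i * (t - s i)) `^ q)).
  move=> i; case: (ltnP i N) => iN; last by exists id.
  have [Z HZ] := ex_tail_antiderivative m q (s i.+1) (spos i (ltnW iN)) (Gd i (ltnW iN)) (g0 i iN).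
  by exists Z.
pose ZN := \sum_(0 <= i < N) (Z i (s i.+1) - Z i (s i)).
have WZ : W <= ZN.
  rewrite WE /ZN !big_nat; apply: ler_sum => i /andP[_ iN].
  have [ss _ _ _] := step i iN; have si := spos i (ltnW iN).
  have := segment_lower si ss (Gd i (ltnW iN)) (g0 i iN) (HZ i iN).
  apply: le_trans; rewrite ler_wpM2r//.
    rewrite subr_ge0 !powRN lef_pV2 ?posrE ?powR_gt0//; last exact: spos.
    by rewrite ge0_ler_powR ?(ltW m_gt0) ?nnegrE ?(ltW si)// ltW// spos.
  rewrite ge0_ler_powR ?(ltW q_gt0) ?nnegrE ?(ltW (Gd i (ltnW iN))) ?G0 ?(ltnW iN)//.
  by rewrite lerDl ltW.
have ZN0 : 0 < ZN by exact: lt_le_trans W0 WZ.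
pose A := extremal_gain X - extremal_gain x0.
have A0 : 0 < A by rewrite subr_gt0; exact: extremal_gain_lt.
pose c := (A / ZN) `^ q^-1.
have c0_gt0 : 0 < c0 by rewrite c0E powR_gt0// divr_gt0.
have c_gt0 : 0 < c by rewrite powR_gt0// divr_gt0.
have cq : c `^ q = A / ZN by rewrite /c -powRrM mulVf ?gt_eqF// powRr1// ltW// divr_gt0.
have cc0 : c <= c0.
  rewrite /c c0E ge0_ler_powR ?invr_ge0 ?(ltW q_gt0) ?nnegrE ?(ltW (divr_gt0 A0 _))//.
  by rewrite ler_wpM2l ?(ltW A0)// lef_pV2 ?posrE.
have Zc : \sum_(0 <= i < N) ((c `^ q \*: Z i) (s i.+1) - (c `^ q \*: Z i) (s i)) = A.
  under eq_bigr do rewrite -mulrBr.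
  by rewrite -mulr_sumr -/ZN cq divfK// gt_eqF.
have [||||||x [x_gt0 zx Yx]] := @path_certificate N s
   (fun i => c * (G i + delta)) (fun i => c `^ p * E i) (fun i => c `^ q \*: Z i) x0 X s0.
- by rewrite mulr_gt0// Gd.
- move=> i iN; have [ss GG EE H] := step i iN; split=> //.
  + by rewrite ler_pM2l// lerD2r.
  + by rewrite ler_pM2l// powR_gt0.
  + rewrite -!mulrBr -mulrA opprD addrACA subrr addr0 powRM ?subr_ge0 ?(ltW c_gt0)//.
    by rewrite ler_pM2l// powR_gt0.
- move=> i iN t ti.
  apply: (is_derive_eq (is_deriveZ (c `^ q) (HZ i iN t ti))).
  have -> : (c * (G i.+1 + delta) - c * (G i + delta)) / (s i.+1 - s i) = c * g i.
    by rewrite -mulrBr opprD addrACA subrr addr0 mulrA.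
  rewrite /GRing.scale/= -[c * g i * _]mulrA -mulrDr.
  rewrite [X in _ = _ * (_ * X)]powRM ?(ltW c_gt0)//.
    rewrite -/m; move: (_ `^ (- _)) ((_ + _) `^ q) (c `^ q) => a b d; ring.
  rewrite addr_ge0 ?(ltW (Gd i _)) ?(ltnW iN)//.
  case/andP: ti => sit _.
  by rewrite mulr_ge0 ?subr_ge0//; exact: g0.
- by [].
- by [].
- by rewrite Zc addrC subrK.
rewrite Zc addrC subrK in zx.
have xX : x = X := extremal_gain_inj x_gt0 X0 zx.
rewrite xX G00 add0r E0 mulr0 subr0 /bellman -/m lerBlDr in Yx.
rewrite lerBlDr.
have U : bellman0 X <= bellman0 X + p / (m + 1) *
   (X `^ (- (r * (p - 1) / p)) * s N `^ (- ((m + 1) * (p - 1) / p)) *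
         (c * (G N + delta)) `^ (m + 1)).
  rewrite lerDl; apply: mulr_ge0 k0 _.
  by apply: mulr_ge0; [apply: mulr_ge0; exact: powR_ge0 | exact: powR_ge0].
apply: (le_trans U); apply: (le_trans Yx).
rewrite -[leRHS]addrA; apply: lerD.
  apply: ler_wpM2r; first exact: EN0.
  by rewrite ge0_ler_powR ?(ltW p_gt0) ?nnegrE ?(ltW c_gt0) ?(ltW c0_gt0).
rewrite [leLHS]addrC; apply: lerD; last exact: lexx.
apply: ler_wpM2l; first exact: k0.
apply: ler_wpM2l; first by rewrite mulr_ge0 ?powR_ge0.
apply: ler_powR2r; first exact: ltW m1_gt0.
  by rewrite mulr_ge0 ?(ltW c_gt0) ?(ltW d0).
by rewrite (ler_pM2r d0).
Qed.

Lemma path_bound (N : nat) (s G E : nat -> R) (x0 X W : R) :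
  0 < s 0%N -> (forall i, (i <= N)%N -> 0 <= G i) -> E 0%N = 0 -> 0 <= E N ->
  G 0%N = 0 ->
  (forall i, (i < N)%N -> [/\ s i <= s i.+1, G i <= G i.+1, E i <= E i.+1 &
   (G i.+1 - G i) `^ p <= (E i.+1 - E i) * (s i.+1 - s i) `^ (p - 1)]) ->
  0 < x0 -> x0 < X ->
  W = \sum_(0 <= i < N) G i `^ q * (s i `^ (- m) - s i.+1 `^ (- m)) -> 0 < W ->
  bellman0 X - bellman0 x0 <= ((extremal_gain X - extremal_gain x0) / W) `^ (p / q) * E N.
Proof.
move=> s0 G0 E0 EN0 G00 step x00 x0X WE W0.
pose c := ((extremal_gain X - extremal_gain x0) / W) `^ q^-1.
have -> : ((extremal_gain X - extremal_gain x0) / W) `^ (p / q) = c `^ p.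
  by rewrite /c -powRrM (mulrC q^-1).
apply/ler_addgt0Pr => eta eta0.
pose C := p / (m + 1) *
    (x0 `^ (- (r * (p - 1) / p)) * s 0%N `^ (- ((m + 1) * (p - 1) / p)) *
     c `^ (m + 1)).
have C0 : 0 <= C.
  apply: mulr_ge0 k0 _.
  by apply: mulr_ge0; [apply: mulr_ge0; exact: powR_ge0 | exact: powR_ge0].
(* [delta <= 1] gives [delta^(m+1) <= delta]. *)
pose delta := Num.min 1 (eta / (C + 1)).
have C1 : 0 < C + 1 by rewrite ltr_wpDl.
have d0 : 0 < delta by rewrite lt_min ltr01 divr_gt0.
apply: le_trans (path_bound_shift s0 G0 E0 EN0 G00 d0 step x00 x0X WE W0 erefl) _.
rewrite lerD2l -/c powRM ?powR_ge0 ?(ltW d0)// [X in _ * X]mulrA [leLHS]mulrA -/C.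
have dd : delta `^ (m + 1) <= delta.
  by rewrite ge1r_powR ?d0 ?ge_min ?lexx// lerDr ltW.
apply: (@le_trans _ _ (C * (eta / (C + 1)))).
  by rewrite ler_wpM2l// (le_trans dd)// ge_min lexx orbT.
by rewrite mulrCA ger_pMr// ler_pdivrMr// mul1r lerDl.
Qed.

Transparent extremal_gain bellman0.

Let n1 : 1 < n.
Proof.
rewrite /n ltr_pdivlMr// mul1r /r.
by move: m_gt0; rewrite /m => ?; lra.
Qed.

(** The boundary term, by which both [extremal_gain] and [bellman0] differ from
the energy up to a constant factor. *)
Let tl (x : R) := x * D x `^ (1 - n).

Let tl_le x : 0 <= x -> 0 <= tl x <= x.
Proof.
move=> x0; rewrite /tl mulr_ge0 ?powR_ge0//=.
rewrite ler_piMr// -[leRHS](powRr0 (D x)); apply: ler_powR.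
  by rewrite /D lerDl powR_ge0.
by rewrite subr_le0 ltW.
Qed.

Let tl_le_powR x : 0 < x -> tl x <= x `^ (- m).
Proof.
move=> x0; rewrite /tl.
have -> : x `^ (- m) = x * (x `^ r) `^ (1 - n).
  rewrite -powRrM -{2}(powRr1 (ltW x0)) -powRD ?(gt_eqF x0) ?implybT//.
  by congr (_ `^ _); rewrite mulrBr rn mulr1 /m /r; lra.
rewrite ler_pM2l// -opprB !powRN lef_pV2 ?posrE ?powR_gt0//.
apply: ler_powR2r; rewrite ?powR_ge0//; first by rewrite subr_ge0 ltW.
by rewrite /D lerDr.
Qed.

Let tl_cvgy : tl x @[x --> +oo] --> 0.
Proof.
apply: (@squeeze_cvgr _ _ _ _ (cst 0) (fun x => x `^ (- m))).
- near=> x; have x0 : 0 < x by near: x; exact: nbhs_pinfty_gt.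
  by rewrite tl_le_powR// andbT; case/andP: (tl_le (ltW x0)).
- exact: cvg_cst.
- exact: powRN_cvgy.
Unshelve. all: by end_near. Qed.

Let tl_cvgV : tl x^-1 @[x --> +oo] --> 0.
Proof.
apply: (@squeeze_cvgr _ _ _ _ (cst 0) (fun x => x^-1)).
- near=> x; have x0 : 0 < x by near: x; exact: nbhs_pinfty_gt.
  by apply: tl_le; rewrite invr_ge0 ltW.
- exact: cvg_cst.
- exact: invx_cvgy.
Unshelve. all: by end_near. Qed.

(** [path_bound] with [x0 = 1/X] and [X] tending to [+oo]: the boundary terms
[x D^(1-n)] vanish at both ends, which leaves [K <= (K / W)^(p/q) E] for the
gain [W]. *)
Lemma discrete_bliss_lt (K : R) (N : nat) (s G E : nat -> R) :
  0 < K -> e x @[x --> +oo] --> K -> e x^-1 @[x --> +oo] --> 0 ->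
  0 < s 0%N -> (forall i, (i <= N)%N -> 0 <= G i) -> E 0%N = 0 -> 0 <= E N ->
  G 0%N = 0 ->
  (forall i, (i < N)%N -> [/\ s i <= s i.+1, G i <= G i.+1, E i <= E i.+1 &
   (G i.+1 - G i) `^ p <= (E i.+1 - E i) * (s i.+1 - s i) `^ (p - 1)]) ->
  \sum_(0 <= i < N) G i `^ q * (s i `^ (- m) - s i.+1 `^ (- m)) <=
    K `^ (- r) * E N `^ (q / p).
Proof.
move=> K0 eK e0 s0 G0 E0 EN0 G00 step.
set W := \sum_(_ <= _ < _) _.
have [W0|W0] := lerP W 0.
  by apply: (le_trans W0); rewrite mulr_ge0 ?powR_ge0.
have uK : bellman0 x - bellman0 x^-1 @[x --> +oo] --> K.
  have := cvgB (cvgB eK (cvgM (cvg_cst (p / (m + 1))) tl_cvgy))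
               (cvgB e0 (cvgM (cvg_cst (p / (m + 1))) tl_cvgV)).
  by rewrite !mulr0 !subr0; apply.
have vK : extremal_gain x - extremal_gain x^-1 @[x --> +oo] --> K.
  by have := cvgB (cvgB eK tl_cvgy) (cvgB e0 tl_cvgV); rewrite !subr0; apply.
have wK : ((extremal_gain x - extremal_gain x^-1) / W) `^ (p / q) * E N @[x --> +oo] -->
    (K / W) `^ (p / q) * E N.
  apply: cvgM; last exact: cvg_cst.
  apply: powR_cvg; first by rewrite divr_gt0.
  by apply: cvgM => //; exact: cvg_cst.
have H : K <= (K / W) `^ (p / q) * E N.
  apply: ler_cvg_to uK wK _; near=> x.
  have x1 : 1 < x by near: x; apply: nbhs_pinfty_gt; exact: num_real.
  have x0 : 0 < x by rewrite (lt_trans _ x1).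
  have xx : x^-1 < x by rewrite (lt_trans _ x1)// invf_lt1.
  have xV : 0 < x^-1 by rewrite invr_gt0.
  exact: (path_bound s0 G0 E0 EN0 G00 step xV xx).
have qp0 : 0 < q / p by rewrite divr_gt0.
have := ler_powR2r (ltW qp0) (ltW K0) H.
rewrite powRM ?powR_ge0// -powRrM (_ : p / q * (q / p) = 1); last first.
  by field; rewrite !gt_eqF.
rewrite powRr1 ?divr_ge0 ?(ltW K0) ?(ltW W0)// => {}H.
have -> : K `^ (- r) = K / K `^ (q / p).
  rewrite -powRN -{2}(powRr1 (ltW K0)) -powRD ?(gt_eqF K0) ?implybT//.
  by rewrite /r opprB.
rewrite mulrAC ler_pdivlMr ?powR_gt0//.
by move: H; rewrite mulrAC ler_pdivlMr// mulrC.
Unshelve. all: by end_near. Qed.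

End extremal.

(** * The energy of the extremal and the Beta function *)

Section beta.
Context {R : realType}.
Local Notation mu := (@lebesgue_measure R).
Implicit Types (a b : R).

Lemma is_derive_LRcontinuous (G g : R -> R) a b : a < b ->
  (forall s, a <= s <= b -> is_derive s 1 G (g s)) ->
  derivable_oo_LRcontinuous G a b.
Proof.
move=> ab dG.
have cG s : a <= s <= b -> {for s, continuous G}.
  move=> sab; apply: differentiable_continuous; apply/derivable1_diffP.
  by have [] := dG s sab.
split.
- move=> s; rewrite in_itv/= => /andP[as_ sb].
  by have [] := dG s; rewrite ?(ltW as_) ?(ltW sb).
- by apply: cvg_at_right_filter; apply: cG; rewrite lexx ltW.
- by apply: cvg_at_left_filter; apply: cG; rewrite lexx ltW.
Qed.

(** For [a < 1] the integrand is singular at 0: the integral is exhausted by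
the intervals [ [1/(k+2), 1] ], where the antiderivative [a^-1 w^a] bounds it by
[a^-1]. *)
Lemma powR_integrable01 a : 0 < a ->
  mu.-integrable `[0, 1] (EFin \o (fun w : R => w `^ (a - 1))).
Proof.
move=> a0.
have mf (A : set (measurableTypeR R)) :
    measurable_fun A (EFin \o (fun w : measurableTypeR R => w `^ (a - 1))).
  by apply/measurable_EFinP; apply: measurable_funTS; exact: measurable_powR.
apply/integrableP; split; first exact: mf.
under eq_integral.
  move=> w _; rewrite /= ger0_norm ?powR_ge0//; over.
rewrite (@integral_itv_bndoo _ 0 1 (fun w => (w `^ (a - 1))%:E)); last exact: mf.
rewrite -(@integral_itv_bndoo _ 0 1 (fun w => (w `^ (a - 1))%:E) false false); last exact: mf.
pose F (k : nat) := `[k.+2%:R^-1, 1 : R]%classic.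
have FU : `]0, 1]%classic = \bigcup_k F k.
  rewrite eqEsubset; split => [x|x [k _]]; rewrite /F/= !in_itv/=.
    move=> /andP[x0 x1]; exists (Num.truncn x^-1) => //=; rewrite in_itv/= x1 andbT.
    rewrite -[leRHS]invrK lef_pV2 ?posrE ?invr_gt0//.
    rewrite ltW// (lt_le_trans (truncnS_gt _))// ler_nat//.
  by move=> /andP[kx ->]; rewrite andbT (lt_le_trans _ kx).
have Fk k : (\int[mu]_(w in F k) (w `^ (a - 1))%:E <= (a^-1)%:E)%E.
  pose G (w : R) := a^-1 * w `^ a.
  have k1 : k.+2%:R^-1 < 1 :> R by rewrite invf_lt1 ?ltr1n.
  have dG (w : R) : 0 < w -> is_derive w 1 G (w `^ (a - 1)).
    move=> w0; apply: (is_derive_eq (is_deriveZ a^-1 (is_derive1_powR a w0))).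
    by rewrite /GRing.scale/= mulrA mulVf ?mul1r// gt_eqF.
  have kpos : 0 < k.+2%:R^-1 :> R by [].
  rewrite (@continuous_FTC2 _ _ G _ _ k1).
  - rewrite -EFinB lee_fin /G powR1 mulr1 gerBl mulr_ge0 ?powR_ge0//.
    by rewrite invr_ge0 ltW.
  - apply: derivable_within_continuous => x; rewrite in_itv/= => /andP[kx _].
    by have [] := is_derive1_powR (a - 1) (lt_le_trans kpos kx).
  - apply: (is_derive_LRcontinuous k1) => x /andP[kx _].
    exact: dG (lt_le_trans kpos kx).
  - move=> x; rewrite in_itv/= => /andP[kx _].
    by rewrite derive1E; have [_ ->] := dG x (lt_trans kpos kx).
rewrite FU.
apply: (@le_lt_trans _ _ (a^-1)%:E); last by rewrite ltry.
have cv : (\int[mu]_(x in F i) (x `^ (a - 1))%:E)%E @[i --> \oo] -->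
    (\int[mu]_(x in \bigcup_i F i) (x `^ (a - 1))%:E)%E.
  apply: ge0_nondecreasing_set_cvg_integral.
  - apply/nondecreasing_seqP => n; rewrite subsetEset /F.
    apply: subset_itvr; rewrite bnd_simp.
    by rewrite lef_pV2 ?posrE// ler_nat.
  - by move=> i; exact: measurable_itv.
  - by move=> i; exact: mf.
  - by move=> i x _; rewrite lee_fin powR_ge0.
by apply: (cvge_to_le cv); exact: nearW.
Qed.

Let bfun a b (w : R) : R := w `^ (a - 1) * (1 - w) `^ (b - 1).

Lemma beta_integrable01 a b : 0 < a -> 1 <= b ->
  mu.-integrable `[0, 1] (EFin \o bfun a b).
Proof.
move=> a0 b1; apply: le_integrable (powR_integrable01 a0) => //.
- apply/measurable_EFinP; apply: measurable_funM.
    by apply: measurable_funTS; exact: measurable_powR.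
  apply: (@measurableT_comp _ _ _ _ _ _ (fun x : R => x `^ (b - 1))).
    exact: measurable_powR.
  by apply: measurable_funB => //; exact: measurable_cst.
- move=> w; rewrite /= in_itv/= => /andP[w0 w1].
  rewrite lee_fin !ger0_norm ?mulr_ge0 ?powR_ge0//.
  rewrite ler_piMr ?powR_ge0//.
  have /le_trans : (1 - w) `^ (b - 1) <= 1 `^ (b - 1) by apply: ler_powR2r; lra.
  by apply; rewrite powR1.
Qed.

Lemma BetaE a b : 0 < a -> 1 <= b ->
  Beta a b = parameterized_integral mu 0 1 (bfun a b).
Proof.
move=> a0 b1; have iab := beta_integrable01 a0 b1.
rewrite /Beta /parameterized_integral -Rintegral_itv_bndo_bndc; last first.
  by apply: integrableS iab => //; apply: subset_itvl; rewrite bnd_simp.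
rewrite -Rintegral_itv_obnd_cbnd//.
by apply: integrableS iab => //; apply: subset_itv; rewrite bnd_simp.
Qed.

Variables (r n : R).
Hypotheses (r_gt0 : 0 < r) (n_gt : 1 <= n - r^-1).
Let a := r^-1.
Let b := n - r^-1.
Let omega (x : R) := x `^ r * (1 + x `^ r)^-1.

(** The energy [int_0^x (1 + t^r)^(-n) dt] after the substitution
[w = t^r / (1 + t^r)], written as an incomplete Beta integral so that its
limit at [+oo] is the complete one. *)
Definition extremal_energy x :=
  r^-1 * parameterized_integral mu 0 (omega x) (bfun a b).

Let D_gt0 (x : R) : 0 < 1 + x `^ r.
Proof. by rewrite ltr_wpDr// powR_ge0. Qed.

Lemma is_derive_extremal_energy (x : R) : 0 < x ->
  is_derive x 1 extremal_energy ((1 + x `^ r) `^ (- n)).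
Proof.
move=> x0; have xr0 : 0 < x `^ r by rewrite powR_gt0.
have a0 : 0 < a by rewrite invr_gt0.
have iab := beta_integrable01 a0 n_gt.
have o0 : 0 < omega x by rewrite /omega divr_gt0.
have o1E : 1 - omega x = (1 + x `^ r)^-1.
  by rewrite /omega; move: (x `^ r) (D_gt0 x) => t t0; field; rewrite gt_eqF.
have o1 : omega x < 1 by rewrite -subr_gt0 o1E invr_gt0.
(* Differentiation under the upper bound needs room to its right. *)
pose u := (omega x + 1) / 2.
have ou : omega x < u by rewrite /u; lra.
have iu : mu.-integrable `[0, u] (EFin \o bfun a b).
  apply: integrableS iab => //; apply: subset_itvl; rewrite bnd_simp /u; lra.
have cb : {for omega x, continuous (bfun a b)}.
  have c1 : {for omega x, continuous (fun w : R => w `^ (a - 1))}.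
    apply: differentiable_continuous; apply/derivable1_diffP.
    by have [] := is_derive1_powR (a - 1) o0.
  have o1' : 0 < 1 - omega x by rewrite subr_gt0.
  have c2 : {for omega x, continuous (fun w : R => (1 - w) `^ (b - 1))}.
    apply: differentiable_continuous; apply/derivable1_diffP.
    have d := is_deriveB (is_derive_cst (1 : R) (omega x) 1)
                         (is_derive_id (omega x) 1).
    by have [] := @is_derive1_comp _ (fun y => y `^ (b - 1)) (cst 1 - id)
      (omega x) _ _      (is_derive1_powR (b - 1) o1') d.
  exact: (continuousM c1 c2).
have [dP P's] := continuous_FTC1_closed ou iu o0 cb.
have dI : is_derive (omega x) 1 (fun y => parameterized_integral mu 0 y (bfun a b))
    (bfun a b (omega x)).
  split; [exact: dP | by rewrite -derive1E; exact: P's].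
have dxr := is_derive1_powR r x0.
have dD : is_derive x 1 (fun y : R => 1 + y `^ r) (r * x `^ (r - 1)).
  apply: (is_derive_eq (is_deriveD (is_derive_cst (1 : R) x 1) dxr)).
  by rewrite add0r.
have dO : is_derive x 1 omega (r * x `^ (r - 1) * ((1 + x `^ r)^-1 * (1 + x `^ r)^-1)).
  have Dn0 : 1 + x `^ r != 0 by rewrite gt_eqF.
  have -> : omega = (fun y => y `^ r) * (fun y => (1 + y `^ r)^-1) by [].
  have dV := @is_deriveV _ (fun y => 1 + y `^ r) x _ _ Dn0 dD.
  apply: (is_derive_eq (is_deriveM dxr dV)).
  rewrite /GRing.scale/=; move: (x `^ r) (x `^ _) Dn0 => t t' Dn0.
  by field.
apply: (is_derive_eq (is_deriveZ r^-1 (is_derive1_comp dI dO))).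
rewrite /GRing.scale/= /bfun o1E.
have DE : 1 + x `^ r = expR (ln (1 + x `^ r)) by rewrite lnK ?posrE.
have oE : omega x = expR (r * ln x - ln (1 + x `^ r)).
  by rewrite expRD expRN -DE -powR_expln.
rewrite oE; move: (1 + x `^ r) (D_gt0 x) => t t0.
have -> : t^-1 = expR (- ln t) by rewrite expRN lnK ?posrE.
rewrite !powR_expln ?expR_gt0// !expRK.
move: (ln t) (ln x) => L X.
rewrite [LHS](_ : _ = (r^-1 * r) * (expR ((a - 1) * (r * X - L)) *
  expR ((b - 1) * - L) * expR ((r - 1) * X) * expR (- L) * expR (- L))); last by ring.
rewrite mulVf ?gt_eqF// mul1r -!expRD; congr expR; rewrite /b /a; field.
by rewrite gt_eqF.
Qed.

Let a_gt0 : 0 < a. Proof. by rewrite invr_gt0. Qed.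

Let omega_ge0 x : 0 <= omega x.
Proof. by rewrite divr_ge0 ?powR_ge0// ltW. Qed.

Let omega_lt1 x : omega x < 1.
Proof. by rewrite /omega ltr_pdivrMr// mul1r ltrDr. Qed.

Let omega_le x : omega x <= x `^ r.
Proof. by rewrite /omega ler_pdivrMr// ler_peMr ?powR_ge0// lerDl powR_ge0. Qed.

Let omega_ge x : 0 < x -> 1 - x `^ (- r) <= omega x.
Proof.
move=> x0; have xr0 : 0 < x `^ r by rewrite powR_gt0.
rewrite /omega powRN; move: (x `^ r) xr0 => t t0.
have t1 : 0 < 1 + t by rewrite addr_gt0.
have -> : t * (1 + t)^-1 = 1 - (1 + t)^-1 by field; rewrite gt_eqF.
by rewrite lerD2l lerN2 lef_pV2 ?posrE// lerDr.
Qed.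

Lemma extremal_energy_cvg0 : extremal_energy x^-1 @[x --> +oo] --> 0.
Proof.
have o0 : omega x^-1 @[x --> +oo] --> 0.
  apply: (@squeeze_cvgr _ _ _ _ (cst 0) (fun x => x `^ (- r))).
  - near=> x; have x0 : 0 < x by near: x; exact: nbhs_pinfty_gt.
    rewrite omega_ge0/= (le_trans (omega_le _))//.
    have -> : x^-1 = x `^ (-1) by rewrite powR_inv1 ?ltW.
    by rewrite -powRrM mulN1r.
  - exact: cvg_cst.
  - exact: powRN_cvgy.
have P0 := parameterized_integral_cvg_left (@ltr01 R) (beta_integrable01 a_gt0 n_gt).
have := cvgM (cvg_cst r^-1) (cvg_comp _ _ o0 P0).
by rewrite mulr0; apply.
Unshelve. all: by end_near. Qed.

Lemma extremal_energy_cvgy :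
  extremal_energy x @[x --> +oo] --> r^-1 * Beta r^-1 (n - r^-1).
Proof.
have o1 : omega x @[x --> +oo] --> (1 : R).
  apply: (@squeeze_cvgr _ _ _ _ (fun x => 1 - x `^ (- r)) (cst 1)).
  - near=> x; have x0 : 0 < x by near: x; exact: nbhs_pinfty_gt.
    by rewrite omega_ge// ltW.
  - have := cvgB (cvg_cst (1 : R)) (powRN_cvgy r_gt0).
    by rewrite subr0; apply.
  - exact: cvg_cst.
have o1l : omega x @[x --> +oo] --> (1 : R)^'-.
  move=> A A1; have H : nbhs (1 : R) (fun u => u < 1 -> A u) by exact: A1.
  have : \forall x \near +oo, omega x < 1 -> A (omega x) by exact: (o1 _ H).
  by apply: filterS => x; apply; exact: omega_lt1.
have P1 := parameterized_integral_cvg_at_left (@ltr01 R) (beta_integrable01 a_gt0 n_gt).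
rewrite BetaE//.
exact: (cvgM (cvg_cst r^-1) (cvg_comp _ _ o1l P1)).
Unshelve. all: by end_near. Qed.

(** Positivity of the Beta integral comes for free, since the energy increases
strictly from 0. *)
Lemma ex_extremal_energy : 0 < Beta r^-1 (n - r^-1) /\
  exists e : R -> R, [/\ forall x : R, 0 < x -> is_derive x 1 e ((1 + x `^ r) `^ (- n)),
    e x^-1 @[x --> +oo] --> 0 & e x @[x --> +oo] --> r^-1 * Beta r^-1 (n - r^-1)].
Proof.
split; last first.
  exists extremal_energy; split; [exact: is_derive_extremal_energy | |].
    exact: extremal_energy_cvg0.
  exact: extremal_energy_cvgy.
have e_lt (x y : R) : 0 < x -> x < y -> extremal_energy x < extremal_energy y.
  move=> x0 xy.
  have [||z _ E] := MVT (f := extremal_energy) (df := fun x => (1 + x `^ r) `^ (- n)) xy.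
  - move=> w; rewrite in_itv/= => /andP[xw _]; apply: is_derive_extremal_energy.
    exact: lt_trans xw.
  - apply: derivable_within_continuous => w; rewrite in_itv/= => /andP[xw _].
    by have [] := is_derive_extremal_energy (lt_le_trans x0 xw).
  - by rewrite -subr_gt0 E mulr_gt0 ?subr_gt0// powR_gt0.
have e1 : 0 <= extremal_energy 1.
  apply: (cvgr_to_le extremal_energy_cvg0); near=> x.
  have x1 : 1 < x by near: x; apply: nbhs_pinfty_gt; exact: num_real.
  have x0 : 0 < x := lt_trans ltr01 x1.
  have xV0 : 0 < x^-1 by rewrite invr_gt0.
  have xV1 : x^-1 < 1 by rewrite invf_lt1.
  exact: ltW (e_lt _ _ xV0 xV1).
have e2 : extremal_energy 2 <= r^-1 * Beta r^-1 (n - r^-1).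
  apply: (cvgr_to_ge extremal_energy_cvgy); near=> x.
  have x2 : 2 < x by near: x; apply: nbhs_pinfty_gt; exact: num_real.
  exact: ltW (e_lt _ _ (ltr0n R 2) x2).
have e12 : extremal_energy 1 < extremal_energy 2 by apply: e_lt; rewrite ?ltr1n ?ltr01.
have := le_lt_trans e1 (lt_le_trans e12 e2).
by rewrite pmulr_rgt0.
Unshelve. all: by end_near. Qed.

End beta.

(** * Discrete Hardy and Bliss inequalities *)

Section hardy.
Context {R : realType}.
Variable p : R.
Hypothesis hp : 1 < p.
Let m := p - 1.
Let c := p / (p - 1).
Let p_gt0 : 0 < p. Proof. by move: hp; lra. Qed.
Let m_gt0 : 0 < m. Proof. by rewrite subr_gt0. Qed.

(** The weight [F^p t^(-m)] plays the part of [bellman]: Young's inequality at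
the slope [F / (c t)], that of the power function [t^(1/c)] which is critical
for Hardy's inequality, shows that it absorbs the gain. *)
Lemma hardy_segment (a b phi g : R) : 0 < a -> a <= b -> 0 < phi -> 0 <= g ->
  p^-1 * (phi `^ p * (a `^ (- m) - b `^ (- m))) +
    ((phi + g * (b - a)) `^ p * b `^ (- m) - phi `^ p * a `^ (- m)) <=
  c `^ m * (g `^ p * (b - a)).
Proof.
move=> a0 ab phi0 g0.
pose F (t : R) := phi + g * (t - a).
have F0 t : a <= t -> phi <= F t.
  by move=> at_; rewrite lerDl mulr_ge0// subr_ge0.
pose h t := F t `^ p * t `^ (- m) - (p^-1 * phi `^ p) * t `^ (- m)
   - c `^ m * g `^ p * (t - a).
suff : h b <= h a.
  move=> H; rewrite -subr_le0 (_ : _ - _ = h b - h a) ?subr_le0//.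
  rewrite /h /F (subrr a) !mulr0 addr0; ring.
have pos t : a <= t <= b -> 0 < t /\ 0 < F t.
  by case/andP => at_ _; rewrite (lt_le_trans a0)// (lt_le_trans phi0 (F0 t at_)).
apply: (@ger_is_derive_le0 _ h (fun t =>
  p * F t `^ m * g * t `^ (- m) - m * (F t `^ p - p^-1 * phi `^ p) * (t `^ (- m) / t)
  - c `^ m * g `^ p) _ _ ab).
- move=> t tab; have [t0 Ft0] := pos t tab.
  have dF : is_derive t 1 F g by exact: is_derive_affine.
  have d1 := is_derive1_comp (is_derive1_powR p Ft0) dF.
  have d2 := is_derive1_powR (- m) t0.
  have d3 : is_derive t 1 (fun t => c `^ m * g `^ p * (t - a)) (c `^ m * g `^ p).
    have := is_derive_affine 0 (c `^ m * g `^ p) a t.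
    by under eq_fun do rewrite add0r.
  apply: (is_derive_eq (is_deriveB (is_deriveB (is_deriveM d1 d2)
    (is_deriveZ (p^-1 * phi `^ p) d2)) d3)).
  rewrite /GRing.scale/= -/m (powRB1 (- m) t0).
  by ring.
- move=> t tab; have [t0 Ft0] := pos t tab.
  have at_ : a <= t by case/andP: tab.
  have C0 : 0 <= F t / t / c by rewrite !divr_ge0 ?ltW// divr_gt0.
  have := young_tangent hp C0 g0; rewrite -/m.
  have c0 : 0 < c by rewrite divr_gt0.
  have Fm : (F t / t / c) `^ m = F t `^ m * t `^ (- m) * (c `^ m)^-1.
    by rewrite powRM ?invr_ge0 ?divr_ge0 ?ltW// powRM ?invr_ge0 ?ltW// !powRV// powRN.
  have C1 : 0 < F t / t / c by rewrite !divr_gt0.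
  rewrite -(mulr_powRB1 (ltW C1) p_gt0) -/m Fm.
  have pF : phi `^ p <= F t * F t `^ m.
    rewrite mulr_powRB1 ?(ltW Ft0)//.
    by apply: ler_powR2r; rewrite ?(ltW p_gt0) ?(ltW phi0) ?F0.
  rewrite -(mulr_powRB1 (ltW Ft0) p_gt0) -/m.
  have cm0 : 0 < c `^ m by rewrite powR_gt0.
  have Tt0 : 0 <= m / p * (t `^ (- m) / t).
    by rewrite mulr_ge0 ?divr_ge0 ?powR_ge0// ltW.
  have cV : c^-1 = 1 - p^-1 by rewrite /c; field; rewrite !gt_eqF.
  move: (ler_wpM2l Tt0 pF) => pF' /(ler_wpM2l (ltW cm0)).
  rewrite -subr_le0 => Y; rewrite -subr_le0 in pF'.
  have := lerD Y pF'; rewrite addr0; apply: le_trans.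
  rewrite le_eqVlt; apply/orP; left; apply/eqP.
  rewrite cV.
  move: (F t `^ m) (t `^ (- m)) (phi `^ p) (g `^ p) (c `^ m) cm0 (F t) => A B E K L L0 S.
  move: (m) => M; field.
  by rewrite !gt_eqF.
Qed.

(** As in the case [p < q], the path is raised by [d] to stay positive, and [d]
is chosen so that the starting value of the weight is the error allowed. *)
Lemma discrete_hardy (N : nat) (s G E : nat -> R) :
  0 < s 0%N -> (forall i, (i <= N)%N -> 0 <= G i) -> E 0%N = 0 ->
  G 0%N = 0 ->
  (forall i, (i < N)%N -> [/\ s i <= s i.+1, G i <= G i.+1, E i <= E i.+1 &
   (G i.+1 - G i) `^ p <= (E i.+1 - E i) * (s i.+1 - s i) `^ (p - 1)]) ->
  \sum_(0 <= i < N) G i `^ p * (s i `^ (- m) - s i.+1 `^ (- m)) <=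
    p * c `^ m * E N.
Proof.
move=> s0 G0 E0 G00 step.
have spos i : (i <= N)%N -> 0 < s i.
  elim: i => [//|i IH] iN; have si := IH (ltnW iN).
  by have [ss _ _ _] := step i iN; exact: lt_le_trans si ss.
rewrite -mulrA mulrC -ler_pdivrMr// mulrC.
apply/ler_addgt0Pr => eta eta0.
pose S := s 0%N `^ (- m).
have S0 : 0 < S by rewrite powR_gt0.
pose d := (eta / S) `^ p^-1.
have d0 : 0 < d by rewrite powR_gt0// divr_gt0.
have dS : d `^ p * S = eta.
  by rewrite /d -powRrM mulVf ?gt_eqF// powRr1 ?divfK ?gt_eqF// ltW// divr_gt0.
suff H k : (k <= N)%N ->
    p^-1 * (\sum_(0 <= i < k) G i `^ p * (s i `^ (- m) - s i.+1 `^ (- m))) +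
    ((G k + d) `^ p * s k `^ (- m) - eta) <= c `^ m * E k.
  have := H N (leqnn _); rewrite addrA lerBlDr; apply: le_trans.
  by rewrite lerDl mulr_ge0 ?powR_ge0.
elim: k => [_|k IH kN].
  by rewrite big_geq// mulr0 add0r G00 add0r -/S dS E0 mulr0 subrr.
have := IH (ltnW kN); have [ss GG EE H] := step k kN.
have dE : 0 <= E k.+1 - E k by rewrite subr_ge0.
have [g0 gG gE] := secant_slope hp ss GG dE H.
have Gd0 : 0 < G k + d by rewrite ltr_wpDl// G0// ltnW.
have sk := spos k (ltnW kN).
have := hardy_segment sk ss Gd0 g0; rewrite addrAC gG.
set g := (_ / _); set w := _ - _ `^ _ => A B.
have w0 : 0 <= w.
  rewrite /w subr_ge0 !powRN lef_pV2 ?posrE ?powR_gt0 ?spos ?(ltnW kN)//.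
  exact: (ler_powR2r (ltW m_gt0) (ltW sk) ss).
have AA : G k `^ p * w <= (G k + d) `^ p * w.
  have Gkd : G k <= G k + d by rewrite lerDl ltW.
  apply: (ler_wpM2r w0); apply: (ler_powR2r (ltW p_gt0) _ Gkd).
  exact: G0 (ltnW kN).
have {}AA : p^-1 * (G k `^ p * w) <= p^-1 * ((G k + d) `^ p * w).
  by rewrite ler_wpM2l ?invr_ge0 ?(ltW p_gt0).
have CE : c `^ m * (g `^ p * (s k.+1 - s k)) <= c `^ m * (E k.+1 - E k).
  by rewrite ler_wpM2l ?powR_ge0.
rewrite big_nat_recr//= -/w mulrDr.
move: A B AA CE; rewrite (mulrBr (c `^ m) (E k.+1)).
move: (p^-1 * \sum_(_ <= _ < _) _) (p^-1 * (G k `^ p * w)) (p^-1 * (_ * w)).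
move: (c `^ m * E k) (c `^ m * E k.+1) (c `^ m * _) ((G k + d) `^ p * _) ((G k.+1 + d) `^ p * _).
by move=> a1 a2 a3 a4 a5 a6 a7 a8; lra.
Qed.

End hardy.

Section discrete_bliss.
Context {R : realType}.
Variables p q : R.
Hypotheses (hp : 1 < p) (hpq : p <= q).
Let m := q / conj_exp p.

Let p_gt0 : 0 < p. Proof. by move: hp; lra. Qed.
Let q_gt0 : 0 < q. Proof. by move: hp hpq; lra. Qed.

Let mE : m = q - q / p.
Proof. by rewrite /m /conj_exp; field; rewrite !gt_eqF// subr_gt0. Qed.

Let rE : p < q -> 0 < q / p - 1.
Proof. by move=> pq; rewrite subr_gt0 ltr_pdivlMr ?mul1r. Qed.

Let nE : p < q -> (q - 1) / (q / p - 1) = q / (q / p - 1) - (q / p - 1)^-1.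
Proof. by move=> pq; rewrite mulrBl mul1r. Qed.

Let n_ge : p < q -> 1 <= q / (q / p - 1) - (q / p - 1)^-1.
Proof.
move=> pq; rewrite -nE// ler_pdivlMr ?rE// mul1r lerD2r.
by rewrite ler_pdivrMr// ler_peMr// ltW.
Qed.

Lemma kconst_gt0 : 0 < kconst q p.
Proof.
rewrite /kconst; case: eqVneq => [_|pq]; first by rewrite mulr_gt0 ?powR_gt0// divr_gt0 ?subr_gt0.
have {pq}pq : p < q by rewrite lt_neqAle pq.
have [B0 _] := ex_extremal_energy (rE pq) (n_ge pq).
by rewrite powR_gt0// divr_gt0 ?rE// nE.
Qed.

(** Here [s] is the mass, [G] the value of the path and [E] its energy at the
successive grid points; the last hypothesis is Hoelder's inequality for the
increments. *)
Lemma discrete_bliss (N : nat) (s G E : nat -> R) :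
  0 < s 0%N -> (forall i, (i <= N)%N -> 0 <= G i) -> E 0%N = 0 -> 0 <= E N ->
  G 0%N = 0 ->
  (forall i, (i < N)%N -> [/\ s i <= s i.+1, G i <= G i.+1, E i <= E i.+1 &
   (G i.+1 - G i) `^ p <= (E i.+1 - E i) * (s i.+1 - s i) `^ (p - 1)]) ->
  \sum_(0 <= i < N) G i `^ q * (s i `^ (- m) - s i.+1 `^ (- m)) <=
    kconst q p `^ q * E N `^ (q / p).
Proof.
move=> s0 G0 E0 EN0 G00 step; rewrite /kconst.
case: eqVneq => [pq|pq].
  have -> : m = p - 1 by rewrite mE -pq divff ?gt_eqF.
  rewrite -pq divff ?gt_eqF// powRr1// powRM ?powR_ge0//.
  rewrite -!powRrM mulVf ?gt_eqF// powRr1 ?(ltW p_gt0)//.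
  have -> : (conj_exp p)^-1 * p = p - 1.
    by rewrite /conj_exp; field; rewrite !gt_eqF// subr_gt0.
  exact: discrete_hardy.
have {pq}pq : p < q by rewrite lt_neqAle pq.
have [B0 [e [de e0 eK]]] := ex_extremal_energy (rE pq) (n_ge pq).
rewrite mE nE//; move: B0 eK; set B := Beta _ _ => B0 eK.
have K0 : 0 < (q / p - 1)^-1 * B by rewrite mulr_gt0// invr_gt0 rE.
apply: le_trans (discrete_bliss_lt hp pq de K0 eK e0 s0 G0 E0 EN0 G00 step) _.
rewrite le_eqVlt; apply/orP; left; apply/eqP; congr (_ * _).
rewrite -powRrM powRN -powRV// invfM invrK; congr (_ `^ _).
by rewrite mulrBl mulVf ?gt_eqF// mulrC.
Qed.

End discrete_bliss.

Section jumps.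
Context {R : realType}.

Lemma sum_by_parts (N : nat) (u w : nat -> R) :
  \sum_(0 <= i < N) u i * (w i - w i.+1) + u N * w N =
  u 0%N * w 0%N + \sum_(0 <= i < N) (u i.+1 - u i) * w i.+1.
Proof.
elim: N => [|N IH]; first by rewrite !big_geq// add0r addr0.
rewrite !big_nat_recr//= [in RHS]addrA -IH; ring.
Qed.

Lemma cvg_nat_sum (T : Type) (F : set_system T) (FF : Filter F) (N : nat)
    (f : nat -> T -> R) (l : nat -> R) :
  (forall i, (i < N)%N -> f i x @[x --> F] --> l i) ->
  \sum_(0 <= i < N) f i x @[x --> F] --> \sum_(0 <= i < N) l i.
Proof.
elim: N => [_|N IH fl].
  by rewrite big_geq//; under eq_fun do rewrite big_geq//; exact: cvg_cst.
rewrite big_nat_recr//=; under eq_fun do rewrite big_nat_recr//=.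
apply: cvgD; last exact: fl.
by apply: IH => i iN; apply: fl; exact: ltnW.
Qed.

Variables p q : R.
Hypotheses (hp : 1 < p) (hpq : p <= q).
Let m := q / conj_exp p.

Let p_gt0 : 0 < p. Proof. by move: hp; lra. Qed.
Let q_gt0 : 0 < q. Proof. by move: hp hpq; lra. Qed.
Let m_gt0 : 0 < m. Proof. by rewrite !divr_gt0// subr_gt0. Qed.

(** Summation by parts needs the gain of the path after its last point.  One
more point is appended at which the path keeps its value and the mass [M] is
so large that what is still missing is at most [eta]. *)
Lemma discrete_bliss_jumps_pos (N : nat) (s G E : nat -> R) :
  0 < s 0%N -> (forall i, (i <= N)%N -> 0 <= G i) -> E 0%N = 0 -> 0 <= E N ->
  G 0%N = 0 ->
  (forall i, (i < N)%N -> [/\ s i <= s i.+1, G i <= G i.+1, E i <= E i.+1 &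
   (G i.+1 - G i) `^ p <= (E i.+1 - E i) * (s i.+1 - s i) `^ (p - 1)]) ->
  \sum_(0 <= i < N) (G i.+1 `^ q - G i `^ q) * s i.+1 `^ (- m) <=
    kconst q p `^ q * E N `^ (q / p).
Proof.
move=> s0 G0 E0 EN0 G00 step.
have := sum_by_parts N (fun i => G i `^ q) (fun i => s i `^ (- m)).
rewrite G00 powR0 ?gt_eqF// mul0r add0r => <-.
apply/ler_addgt0Pr => eta eta0.
pose c := G N `^ q.
have c0 : 0 <= c by exact: powR_ge0.
have c1 : 0 < c + 1 by rewrite ltr_wpDl.
pose M := Num.max (s N) (((c + 1) / eta) `^ m^-1).
pose ext (u : nat -> R) (l : R) i := if (i <= N)%N then u i else l.
have := @discrete_bliss _ p q hp hpq N.+1 (ext s M) (ext G (G N)) (ext E (E N)).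
rewrite /ext /= ltnn => H.
have {}H := H s0 _ E0 EN0 G00 _.
have cM : c * M `^ (- m) <= eta.
  have M0 : 0 < ((c + 1) / eta) `^ m^-1 by rewrite powR_gt0// divr_gt0.
  have : (((c + 1) / eta) `^ m^-1) `^ m <= M `^ m.
    by apply: ler_powR2r; rewrite ?(ltW m_gt0) ?(ltW M0)// le_max lexx orbT.
  rewrite -powRrM mulVf ?gt_eqF// powRr1; last by rewrite ltW// divr_gt0.
  rewrite powRN ler_pdivrMr// => cM.
  rewrite ler_pdivrMr ?powR_gt0// ?lt_max ?M0 ?orbT//.
  by rewrite mulrC (le_trans _ cM)// lerDl.
rewrite -lerBlDr; apply: le_trans (H _ _).
- rewrite big_nat_recr//= leqnn ltnn -/c.
  rewrite [X in X + c * (_ - _)](eq_big_nat _ _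
    (F2 := fun i => G i `^ q * (s i `^ (- m) - s i.+1 `^ (- m)))); last first.
    by move=> i /andP[_ iN]; rewrite (ltnW iN) iN.
  by rewrite mulrBr -addrA lerD2l lerD2l lerN2.
- by move=> i; case: ifP => // iN _; exact: G0.
- move=> i; rewrite ltnS leq_eqVlt => /predU1P[->|iN].
    rewrite eqxx ltnn/= !lexx !subrr mul0r powR0 ?gt_eqF//; split=> //.
    by rewrite le_max lexx.
  by rewrite iN orbT; exact: step.
Qed.

(** Starting from mass 0, all masses are raised by [eps] and [eps] tends to 0.  A
mass which is still 0 gives no trouble, as the path has not left 0 there and
the coefficient of the singular power vanishes. *)
Lemma discrete_bliss_jumps (N : nat) (s G E : nat -> R) :
  s 0%N = 0 -> (forall i, (i <= N)%N -> 0 <= G i) -> E 0%N = 0 -> 0 <= E N ->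
  G 0%N = 0 ->
  (forall i, (i < N)%N -> [/\ s i <= s i.+1, G i <= G i.+1, E i <= E i.+1 &
   (G i.+1 - G i) `^ p <= (E i.+1 - E i) * (s i.+1 - s i) `^ (p - 1)]) ->
  \sum_(0 <= i < N) (G i.+1 `^ q - G i `^ q) * s i.+1 `^ (- m) <=
    kconst q p `^ q * E N `^ (q / p).
Proof.
move=> s0 G0 E0 EN0 G00 step.
have spos i : (i <= N)%N -> 0 <= s i.
  elim: i => [_|i IH iN]; first by rewrite s0.
  by have [ss _ _ _] := step i iN; exact: le_trans (IH (ltnW iN)) ss.
pose f (eps : R) := \sum_(0 <= i < N) (G i.+1 `^ q - G i `^ q) * (eps + s i.+1) `^ (- m).
have fl : f eps @[eps --> 0^'+] -->
    \sum_(0 <= i < N) (G i.+1 `^ q - G i `^ q) * s i.+1 `^ (- m).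
  apply: cvg_nat_sum => i iN; have [ss GG EE H] := step i iN.
  have := spos i.+1 iN; rewrite le_eqVlt => /predU1P[s0'|s0'].
    have ss0 : s i.+1 - s i = 0.
      by apply/eqP; rewrite subr_eq0 eq_le ss -s0' spos// ltnW.
    have -> : G i.+1 = G i.
      apply/eqP; rewrite -subr_eq0; apply/eqP.
      apply: (@powR_eq0_eq0 _ _ p); apply/eqP; rewrite eq_le powR_ge0 andbT.
      by apply: le_trans H _; rewrite ss0 powR0 ?mulr0// subr_eq0 gt_eqF.
    under eq_fun do rewrite subrr mul0r.
    by rewrite subrr mul0r; exact: cvg_cst.
  apply: cvgM; first exact: cvg_cst.
  apply: powR_cvg => //; rewrite -[X in _ --> X]add0r; apply: cvgD; last exact: cvg_cst.
  by apply: (@cvg_at_right_filter _ _ id); exact: cvg_id.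
apply: (cvgr_to_le fl); near=> eps.
have eps0 : 0 < eps by near: eps; exact: nbhs_right_gt.
have := @discrete_bliss_jumps_pos N (fun i => eps + s i) G E.
rewrite s0 addr0 => H; apply: H => //.
move=> i iN; have [ss GG EE HH] := step i iN; split=> //; first by rewrite lerD2l.
by rewrite opprD addrACA subrr add0r.
Unshelve. all: by end_near. Qed.

End jumps.

(** * From finite grids to measures *)

Section nested_sets.
Context {R : realType} (d : measure_display) (T : measurableType d).
Variable nu : {measure set T -> \bar R}.
Variables (p q : R) (f : T -> R).
Hypotheses (hp : 1 < p) (hpq : p <= q).
Hypothesis mf : measurable_fun setT f.
Hypothesis f0 : forall y, 0 <= f y.
Let m := q / conj_exp p.
Let p_gt0 : 0 < p. Proof. by move: hp; lra. Qed.

Let mfE (A : set T) : measurable_fun A (EFin \o f).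
Proof. by apply/measurable_EFinP; exact: measurable_funTS. Qed.

Let mfp (A : set T) : measurable_fun A (fun y => (f y `^ p)%:E).
Proof.
apply/measurable_EFinP; apply: measurable_funTS.
by apply: (@measurableT_comp _ _ _ _ _ _ (fun x : R => x `^ p)).
Qed.

Local Notation If A := (\int[nu]_(y in A) (f y)%:E)%E.
Local Notation Ip A := (\int[nu]_(y in A) (f y `^ p)%:E)%E.

Lemma integral_young (A : set T) (c : R) : measurable A -> 0 <= c ->
  ((p * c `^ (p - 1))%:E * If A <=
   Ip A + ((p - 1) * c `^ p)%:E * nu A)%E.
Proof.
move=> mA c0.
have p1 : 0 <= p - 1 by rewrite subr_ge0 ltW.
rewrite -ge0_integralZl_EFin//; last by rewrite mulr_ge0 ?powR_ge0// ltW.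
  rewrite -integral_cst// -ge0_integralD//.
  - apply: ge0_le_integral => //.
    + by move=> y _; rewrite -EFinM lee_fin !mulr_ge0 ?powR_ge0// ltW.
    + by apply: emeasurable_funM => //; exact: measurable_cst.
    + by apply: emeasurable_funD => //; exact: measurable_cst.
    + by move=> y _; rewrite -EFinM -EFinD lee_fin young_tangent.
  - by move=> y _; rewrite lee_fin powR_ge0.
  - by move=> y _; rewrite /= lee_fin mulr_ge0// powR_ge0.
by move=> y _; rewrite lee_fin.
Qed.

(** Young's inequality is integrated at the mean value [c] of [f] over [A]; at
[c = 1] it first shows that the integral of [f] is finite. *)
Lemma hoelder_set (A : set T) : measurable A -> (nu A < +oo)%E ->
  (Ip A < +oo)%E ->
  (If A < +oo)%E /\
  fine (If A) `^ p <=
    fine (Ip A) * fine (nu A) `^ (p - 1).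
Proof.
move=> mA nuA fpA.
have F0 : (0 <= If A)%E.
  by apply: integral_ge0 => y _; rewrite lee_fin.
have E0 : (0 <= Ip A)%E.
  by apply: integral_ge0 => y _; rewrite lee_fin powR_ge0.
have nuAfin : nu A \is a fin_num by rewrite ge0_fin_numE.
have Efin : Ip A \is a fin_num by rewrite ge0_fin_numE.
have Ffin : (If A < +oo)%E.
  have := integral_young mA (@ler01 R); rewrite !powR1 !mulr1 => H.
  rewrite -(@lte_pmul2l _ p%:E) ?lte_fin//.
  apply: (le_lt_trans H); rewrite gt0_muley ?lte_fin//.
  by rewrite lte_add_pinfty// lte_mul_pinfty// ?lee_fin ?subr_ge0 ltW.
split=> //.
have {}Ffin : If A \is a fin_num by rewrite ge0_fin_numE.
have Y c : 0 <= c -> p * c `^ (p - 1) * fine (If A) <=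
    fine (Ip A) + (p - 1) * c `^ p * fine (nu A).
  move=> c0; have := integral_young mA c0.
  rewrite -{1}(fineK Ffin) -{1}(fineK Efin) -{1}(fineK nuAfin).
  by rewrite -!EFinM -EFinD lee_fin.
have [nA0|nA0] := eqVneq (nu A) 0%E.
  have -> : (If A = 0)%E.
    by apply: null_set_integral.
  by rewrite /= powR0 ?gt_eqF// mulr_ge0 ?powR_ge0 ?fine_ge0.
have {nA0}nA0 : 0 < fine (nu A).
  by rewrite fine_gt0// nuA andbT lt_neqAle eq_sym nA0 measure_ge0.
move: (fine (If A)) (fine (nu A)) (fine (Ip A)) nA0 Y (fine_ge0 F0) (fine_ge0 E0).
move=> F n E n0 Y {}F0 {}E0.
have [->|Fn0] := eqVneq F 0.
  by rewrite powR0 ?gt_eqF// mulr_ge0 ?powR_ge0// ltW.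
have {}F0 : 0 < F by rewrite lt_neqAle eq_sym Fn0.
have c0 : 0 < F / n by rewrite divr_gt0.
have := Y _ (ltW c0).
rewrite -(mulr_powRB1 (ltW c0) p_gt0).
have -> : (p - 1) * (F / n * (F / n) `^ (p - 1)) * n = (p - 1) * (F / n) `^ (p - 1) * F.
  by field; rewrite gt_eqF.
rewrite -lerBlDr.
have -> : p * (F / n) `^ (p - 1) * F - (p - 1) * (F / n) `^ (p - 1) * F =
  F * (F / n) `^ (p - 1) by ring.
rewrite powRM ?invr_ge0 ?(ltW F0) ?(ltW n0)// mulrA mulr_powRB1 ?(ltW F0)//.
by rewrite powRV// ler_pdivrMr ?powR_gt0.
Qed.

(** The discrete inequality for the path formed by the masses and the integrals
over an increasing sequence of sets.  The first part records what is needed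
to read the sum in the extended reals, where the power may be infinite. *)
Lemma nested_bliss (B : nat -> set T) (N : nat) :
  (forall i, measurable (B i)) -> B 0%N = set0 ->
  (forall i, B i `<=` B i.+1) -> (forall i, (i <= N)%N -> (nu (B i) < +oo)%E) ->
  (Ip [set: T] < +oo)%E ->
  let g i := fine (If (B i)) in
  (forall i, (i < N)%N -> [/\ g i <= g i.+1,
     nu (B i.+1) = (fine (nu (B i.+1)))%:E,
     If (B i.+1) = (g i.+1)%:E & (fine (nu (B i.+1)) = 0 -> g i.+1 = g i)]) /\
  \sum_(0 <= i < N) (g i.+1 `^ q - g i `^ q) * fine (nu (B i.+1)) `^ (- m) <=
    kconst q p `^ q * fine (Ip [set: T]) `^ (q / p).
Proof.
move=> mB B0 BS nuB IpT g.
have If0 A : (0 <= If A)%E by apply: integral_ge0 => y _; rewrite lee_fin.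
have Ip0 A : (0 <= Ip A)%E.
  by apply: integral_ge0 => y _; rewrite lee_fin powR_ge0.
have IpA A : measurable A -> (Ip A <= Ip [set: T])%E.
  move=> mA; apply: ge0_subset_integral => //.
  by move=> y _; rewrite lee_fin powR_ge0.
have IpF A : measurable A -> Ip A = (fine (Ip A))%:E.
  by move=> mA; rewrite fineK// ge0_fin_numE// (le_lt_trans (IpA _ mA)).
have IfF i : (i <= N)%N -> If (B i) = (g i)%:E.
  move=> iN; rewrite /g fineK// ge0_fin_numE//.
  by have [] := hoelder_set (mB i) (nuB i iN) (le_lt_trans (IpA _ (mB i)) IpT).
have nuF i : (i <= N)%N -> nu (B i) = (fine (nu (B i)))%:E.
  by move=> iN; rewrite fineK// ge0_fin_numE// nuB.
pose A i := B i.+1 `\` B i.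
have mA i : measurable (A i) by exact: measurableD.
have BU i : B i.+1 = B i `|` A i by rewrite setDUK.
have disj i : [disjoint B i & A i] by rewrite disj_set2E setDIK.
have nuA i : (i < N)%N -> (nu (A i) < +oo)%E.
  move=> iN; apply: (le_lt_trans _ (nuB i.+1 iN)).
  by apply: le_measure; rewrite ?inE//; exact: subDsetl.
have gA i : (i < N)%N -> If (A i) = (g i.+1 - g i)%:E.
  move=> iN.
  have [AF _] := hoelder_set (mA i) (nuA i iN) (le_lt_trans (IpA _ (mA i)) IpT).
  have AE : If (A i) = (fine (If (A i)))%:E by rewrite fineK// ge0_fin_numE.
  have : If (B i.+1) = (If (B i) + If (A i))%E.
    rewrite [X in (\int[nu]_(_ in X) _)%E](BU i); apply: ge0_integral_setU => //.
    by move=> y _; rewrite lee_fin.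
  rewrite IfF// IfF ?(ltnW iN)// AE -EFinD => -[->].
  by rewrite addrAC subrr add0r.
have eA i : (i < N)%N -> fine (Ip (A i)) = fine (Ip (B i.+1)) - fine (Ip (B i)).
  move=> iN; have : Ip (B i.+1) = (Ip (B i) + Ip (A i))%E.
    rewrite [X in (\int[nu]_(_ in X) _)%E](BU i); apply: ge0_integral_setU => //.
    by move=> y _; rewrite lee_fin powR_ge0.
  rewrite (IpF _ (mB i.+1)) (IpF _ (mB i)) (IpF _ (mA i)) -EFinD => -[->].
  by rewrite addrAC subrr add0r.
have sA i : (i < N)%N -> fine (nu (A i)) = fine (nu (B i.+1)) - fine (nu (B i)).
  move=> iN; have : nu (B i.+1) = (nu (B i) + nu (A i))%E.
    by rewrite [X in nu X = _](BU i); apply: measureU => //; rewrite setDIK.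
  have AE : nu (A i) = (fine (nu (A i)))%:E by rewrite fineK// ge0_fin_numE// nuA.
  rewrite (nuF _ iN) (nuF _ (ltnW iN)) AE -EFinD => -[->].
  by rewrite addrAC subrr add0r.
have step i : (i < N)%N -> [/\ fine (nu (B i)) <= fine (nu (B i.+1)), g i <= g i.+1,
    fine (Ip (B i)) <= fine (Ip (B i.+1)) &
   (g i.+1 - g i) `^ p <= (fine (Ip (B i.+1)) - fine (Ip (B i))) *
     (fine (nu (B i.+1)) - fine (nu (B i))) `^ (p - 1)].
  move=> iN; rewrite -eA// -sA//; split.
  - by rewrite -subr_ge0 -sA// fine_ge0.
  - by rewrite -subr_ge0 -lee_fin -gA.
  - by rewrite -subr_ge0 -eA// fine_ge0.
  - have [_] := hoelder_set (mA i) (nuA i iN) (le_lt_trans (IpA _ (mA i)) IpT).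
    by rewrite gA.
split.
  move=> i iN; have [ss gg EE H] := step i iN.
  split=> //; [exact: nuF | exact: IfF |].
  move=> s0; apply/eqP; rewrite -subr_eq0; apply/eqP.
  apply: (@powR_eq0_eq0 _ _ p); apply/eqP; rewrite eq_le powR_ge0 andbT.
  apply: le_trans H _; rewrite s0.
  have -> : 0 - fine (nu (B i)) = 0.
    by apply/eqP; rewrite sub0r oppr_eq0 eq_le fine_ge0// andbT -s0.
  by rewrite powR0 ?mulr0// subr_eq0 gt_eqF.
have q0 : 0 <= q / p by rewrite divr_ge0 ?ltW// (lt_le_trans p_gt0).
apply: (@le_trans _ _ (kconst q p `^ q * fine (Ip (B N)) `^ (q / p))).
  apply: (@discrete_bliss_jumps _ p q hp hpq N (fun i => fine (nu (B i))) g
     (fun i => fine (Ip (B i)))) => //.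
  - by rewrite B0 measure0.
  - by move=> i _; exact: fine_ge0.
  - by rewrite B0 integral_set0.
  - exact: fine_ge0.
  - by rewrite /g B0 integral_set0.
apply: ler_wpM2l; first exact: powR_ge0.
apply: (ler_powR2r q0); first exact: fine_ge0.
rewrite -lee_fin -(IpF _ (mB N)) -(IpF _ measurableT); exact: IpA.
Qed.

End nested_sets.

Section ereal_facts.
Context {R : realType}.
Local Open Scope ereal_scope.

Lemma nondecreasing_emeasurable (h : measurableTypeR R -> \bar R) :
  (forall x y : R, (x <= y)%R -> h x <= h y) -> measurable_fun setT h.
Proof.
move=> nh; apply: (measurability _ (ErealGenCInfty.measurableE R)) => //.
move=> _ [_ [r ->] <-]; rewrite setTI.
apply: is_interval_measurable => s t /=.
rewrite !in_itv/= !andbT => hs ht u /andP[su ut].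
by rewrite in_itv/= andbT (le_trans hs)// nh.
Qed.

Lemma limn_einf_ge (u : (\bar R)^nat) (c : \bar R) :
  (\forall n \near \oo, c <= u n) -> c <= limn_einf u.
Proof.
move=> [N _ Nu]; rewrite limn_einf_lim.
apply: lime_ge; first exact: is_cvg_einfs.
exists N => // n /= Nn; apply: le_ereal_inf_tmp => _ [k /= nk <-].
by apply: Nu => /=; exact: leq_trans nk.
Qed.

Lemma distr_le (nu : {measure set (measurableTypeR R) -> \bar R}) (x y : R) :
  (x <= y)%R -> distr nu x <= distr nu y.
Proof.
move=> xy; apply: le_measure; rewrite ?inE; try exact: measurable_itv.
by apply: subset_itvl; rewrite bnd_simp.
Qed.

End ereal_facts.

Section transfer.
Context {R : realType}.
Variables (p q : R).
Hypotheses (hp : 1 < p) (hpq : p <= q).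
Variables (nu nut : {measure set (measurableTypeR R) -> \bar R}).
Hypothesis hnut : forall x : R,
  nut [set` `]x, +oo[%R] = neg_power (distr nu x) (q / conj_exp p).
Variable f : measurableTypeR R -> R.
Hypotheses (mf : measurable_fun setT f) (f0 : forall y, 0 <= f y).
Let m := q / conj_exp p.
Let p_gt0 : 0 < p. Proof. by move: hp; lra. Qed.
Let q_gt0 : 0 < q. Proof. by move: hp hpq; lra. Qed.
Let m_gt0 : 0 < m. Proof. by rewrite !divr_gt0// subr_gt0. Qed.

Local Notation If A := (\int[nu]_(y in A) (f y)%:E)%E.
Local Notation Ip A := (\int[nu]_(y in A) (f y `^ p)%:E)%E.
Hypothesis IpT : (Ip [set: R] < +oo)%E.
Let C := kconst q p `^ q * fine (Ip [set: R]) `^ (q / p).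

Section grid.
Variable x : nat -> R.
Hypothesis x_ndecr : forall i, x i <= x i.+1.

(** Shifted by one, so that the path starts with the empty set at mass 0. *)
Definition grid_set i : set (measurableTypeR R) :=
  if i is i'.+1 then [set` `]-oo, x i']%R] else set0.

Definition grid_mass i := fine (If (grid_set i)).

Definition grid_jump i := grid_mass i.+1 `^ q - grid_mass i `^ q.

Let x_le i j : (i <= j)%N -> x i <= x j.
Proof. by move=> ij; apply: (homo_leq (@lexx _ _) (@le_trans _ _) x_ndecr). Qed.

Let grid_nested N : (forall i, (i < N)%N -> (distr nu (x i) < +oo)%E) ->
  (forall i, (i < N)%N -> [/\ grid_mass i <= grid_mass i.+1,
     nu (grid_set i.+1) = (fine (nu (grid_set i.+1)))%:E,
     If (grid_set i.+1) = (grid_mass i.+1)%:E &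
     (fine (nu (grid_set i.+1)) = 0 -> grid_mass i.+1 = grid_mass i)]) /\
  \sum_(0 <= i < N) grid_jump i * fine (nu (grid_set i.+1)) `^ (- m) <= C.
Proof.
move=> fin; apply: (nested_bliss hp hpq mf f0 _ _ _ _ IpT) => //.
- by case=> [|i]; [exact: measurable0 | exact: measurable_itv].
- by case=> [|i] //=; apply: subset_itvl; rewrite bnd_simp.
- by case=> [|i] iN; [rewrite measure0 ltry | exact: fin].
Qed.

Let grid_mass0 : grid_mass 0 = 0.
Proof. by rewrite /grid_mass /= integral_set0. Qed.

Lemma grid_jump_ge0 i : (distr nu (x i) < +oo)%E -> 0 <= grid_jump i.
Proof.
move=> fi.
have [|H _] := @grid_nested i.+1.
  move=> j; rewrite ltnS => ji; apply: le_lt_trans fi.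
  by apply: distr_le; exact: x_le.
have [gg _ _ _] := H i (ltnSn i).
rewrite subr_ge0; apply: (ler_powR2r (ltW q_gt0) _ gg).
by apply: fine_ge0; apply: integral_ge0 => y _; rewrite lee_fin.
Qed.

(** Jumps at points of infinite mass are discarded: [nut] does not see them and
their real values mean nothing. *)
Definition grid_coef i := if (distr nu (x i) < +oo)%E then grid_jump i else 0.

Lemma grid_coef_ge0 i : 0 <= grid_coef i.
Proof. by rewrite /grid_coef; case: ifPn => // fi; exact: grid_jump_ge0. Qed.

(** The tail [nut ]x_i, +oo[ ] is the power [S(x_i)^(-m)] of the discrete
inequality; when [S(x_i) = 0] it is infinite but the jump is 0. *)
Lemma grid_bound L :
  (\sum_(0 <= i < L) (grid_coef i)%:E * nut [set` `]x i, +oo[%R] <= C%:E)%E.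
Proof.
elim: L => [|L IH].
  by rewrite big_geq// lee_fin mulr_ge0 ?powR_ge0.
have [fL|fL] := boolP (distr nu (x L) < +oo)%E; last first.
  by rewrite big_nat_recr//= {2}/grid_coef (negbTE fL) mul0e adde0.
have fin i : (i < L.+1)%N -> (distr nu (x i) < +oo)%E.
  rewrite ltnS => iL; apply: le_lt_trans fL.
  by apply: distr_le; exact: x_le.
have [H1 H2] := grid_nested fin.
rewrite -lee_fin -sumEFin in H2; apply: le_trans H2.
rewrite le_eqVlt; apply/orP; left; apply/eqP; apply: eq_big_nat => i /andP[_ iL].
have [_ nuE _ g0] := H1 i iL.
rewrite /grid_coef fin// hnut /distr -/(grid_set i.+1) nuE /neg_power -/m.
rewrite poweR_EFin inver EFinM.
case: eqVneq => [s0|s0]; last by rewrite powRN.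
rewrite /grid_jump g0 ?subrr ?mul0e//.
exact: powR_eq0_eq0 s0.
Qed.

Lemma grid_sum i : (distr nu (x i) < +oo)%E ->
  \sum_(0 <= j < i.+1) grid_coef j = grid_mass i.+1 `^ q.
Proof.
move=> fi.
have fin j : (j < i.+1)%N -> (distr nu (x j) < +oo)%E.
  rewrite ltnS => iL; apply: le_lt_trans fi.
  by apply: distr_le; exact: x_le.
rewrite (eq_big_nat _ _ (F2 := grid_jump)); last first.
  by move=> j /andP[_ ji]; rewrite /grid_coef fin.
by rewrite telescope_sumr// grid_mass0 powR0 ?subr0// gt_eqF.
Qed.

Definition grid_fun L (y : measurableTypeR R) : \bar R :=
  (\sum_(0 <= i < L) (grid_coef i * \1_[set` `]x i, +oo[%R] y)%:E)%E.

Lemma grid_fun_ge0 L y : (0 <= grid_fun L y)%E.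
Proof.
by apply: sume_ge0 => i _; rewrite lee_fin mulr_ge0 ?grid_coef_ge0.
Qed.

Lemma measurable_grid_fun L : measurable_fun setT (grid_fun L).
Proof.
apply: emeasurable_fun_sum => i; apply/measurable_EFinP.
by apply: measurable_funM => //; apply: measurable_indic; exact: measurable_itv.
Qed.

Lemma integral_grid_fun L : (\int[nut]_y grid_fun L y <= C%:E)%E.
Proof.
apply: le_trans (grid_bound L); rewrite le_eqVlt; apply/orP; left; apply/eqP.
rewrite ge0_integral_sum//.
- apply: eq_bigr => i _; under eq_integral do rewrite EFinM.
  rewrite ge0_integralZl_EFin ?grid_coef_ge0//.
    by rewrite integral_indic ?setIT//; exact: measurable_itv.
  by apply/measurable_EFinP; apply: measurable_indic; exact: measurable_itv.
- move=> i; apply/measurable_EFinP.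
  by apply: measurable_funM => //; apply: measurable_indic; exact: measurable_itv.
- by move=> i y _; rewrite lee_fin mulr_ge0 ?grid_coef_ge0.
Qed.

Lemma grid_fun_ge L (y z : R) i : (i < L)%N -> y <= x i -> x i < z ->
  (distr nu (x i) < +oo)%E ->
  ((If [set` `]-oo, y]%R]) `^ q <= grid_fun L z)%E.
Proof.
move=> iL yx xz fi.
have [|H _] := @grid_nested i.+1.
  move=> j; rewrite ltnS => ji; apply: le_lt_trans fi.
  by apply: distr_le; exact: x_le.
have [_ _ IE _] := H i (ltnSn i).
apply: (@le_trans _ _ ((If (grid_set i.+1)) `^ q)%E).
  apply: gt0_ler_poweR; rewrite ?(ltW q_gt0)// ?in_itv/= ?leey ?andbT.
  - by apply: integral_ge0 => t _; rewrite lee_fin.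
  - by apply: integral_ge0 => t _; rewrite lee_fin.
  apply: ge0_subset_integral => //; [exact: measurable_itv..| | | ].
  - by apply/measurable_EFinP; exact: measurable_funTS.
  - by move=> t _; rewrite lee_fin.
  - by apply: subset_itvl; rewrite bnd_simp.
rewrite IE poweR_EFin -(grid_sum fi) /grid_fun sumEFin lee_fin.
rewrite [leRHS](big_cat_nat (leq0n i.+1) iL)/=.
rewrite ler_wpDr//.
  by apply: sumr_ge0 => j _; rewrite mulr_ge0 ?grid_coef_ge0.
rewrite !big_nat; apply: ler_sum => j /andP[_ ji].
rewrite indicE mem_set ?mulr1//= in_itv/= andbT.
by apply: le_lt_trans xz; apply: x_le; rewrite -ltnS.
Qed.

End grid.

Definition mesh (n i : nat) : R := i%:R / n.+1%:R - n.+1%:R.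

Lemma mesh_ndecr n i : mesh n i <= mesh n i.+1.
Proof. by rewrite lerD2r ler_pM2r ?invr_gt0// ler_nat. Qed.

(** As many points of step [1/(n+1)] as cover the interval from [-(n+1)] to
[n+1]. *)
Definition mesh_size n := (n.+1 * n.+1).*2.

(** The point is the first one of the mesh to the right of [y]. *)
Lemma mesh_dense (y z : R) : y < z -> \forall n \near \oo,
  exists2 i, (i < mesh_size n)%N & y <= mesh n i < z.
Proof.
move=> yz; near=> n; pose K : R := n.+1%:R.
have nK : n%:R <= K by rewrite ler_nat.
have K0 : 0 < K by [].
have yK : - y < K by apply: lt_le_trans nK; near: n; exact: nbhs_infty_gtr.
have zK : z < K by apply: lt_le_trans nK; near: n; exact: nbhs_infty_gtr.
have dK : (z - y)^-1 < K by apply: lt_le_trans nK; near: n; exact: nbhs_infty_gtr.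
pose t := (y + K) * K.
have t0 : 0 <= t.
  by apply: mulr_ge0; [rewrite -(opprK y) addrC subr_ge0 ltW|exact: ltW].
have /andP[it ti] := truncn_itv t0.
set i := (Num.truncn t).+1 in ti.
have iz : i%:R / K - K < z.
  rewrite ltrBlDr ltr_pdivrMr//.
  have : 1 < (z - y) * K by rewrite -ltr_pdivrMl ?subr_gt0// mulr1.
  have : i%:R <= t + 1 by rewrite /i -natr1 lerD2r.
  rewrite /t; move: (i%:R) => I H1 H2; apply: (le_lt_trans H1).
  by rewrite -subr_gt0 in H2; rewrite -subr_gt0; apply: (lt_le_trans H2); lra.
exists i; last first.
  by rewrite /mesh -/K iz andbT lerBrDr ler_pdivlMr// ltW.
rewrite -(ltr_nat R) /mesh_size -muln2 !natrM -/K.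
move: iz; rewrite ltrBlDr ltr_pdivrMr// => /lt_le_trans; apply.
by rewrite mulrAC ler_pM2r// mulr_natr mulr2n lerD2r ltW.
Unshelve. all: by end_near. Qed.

Let psi n := grid_fun (mesh n) (mesh_size n).

(** The points with finite mass strictly to their left. *)
Let good : set (measurableTypeR R) :=
  [set z | forall y, y < z -> (distr nu y < +oo)%E].

(** Any [y < z] is eventually separated from [z] by a point of the mesh, so the
step functions at [z] exceed the integral up to [y]; the open half-line is
the union of such closed ones. *)
Lemma integral_le_liminf (z : R) : good z ->
  ((If [set` `]-oo, z[%R]) `^ q <= limn_einf (fun n => psi n z))%E.
Proof.
move=> gz; set l := limn_einf _.
have l0 : (0 <= l)%E.
  by apply: limn_einf_ge; apply: nearW => n; exact: (grid_fun_ge0 (mesh_ndecr n)).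
have below y : y < z -> ((If [set` `]-oo, y]%R]) `^ q <= l)%E.
  move=> yz; apply: limn_einf_ge.
  apply: filterS (mesh_dense yz) => n [i iL /andP[yi iz]].
  exact: (grid_fun_ge (mesh_ndecr n) iL yi iz (gz _ iz)).
pose A k : set (measurableTypeR R) := [set` `]-oo, z - k.+1%:R^-1]%R].
have AU : [set` `]-oo, z[%R] = \bigcup_k A k.
  rewrite eqEsubset; split => [y|y [k _]]; rewrite /A/= !in_itv/=.
    rewrite -subr_gt0 => yz; exists (Num.truncn (z - y)^-1) => //=.
    rewrite in_itv/= lerBrDl -lerBrDr -[leRHS]invrK lef_pV2 ?posrE ?invr_gt0//.
    exact: ltW (truncnS_gt _).
  by move=> /le_lt_trans; apply; rewrite ltrBlDr ltrDl invr_gt0.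
have cv : If (A k) @[k --> \oo] --> If [set` `]-oo, z[%R].
  rewrite AU; apply: ge0_nondecreasing_set_cvg_integral.
  - apply/nondecreasing_seqP => n; rewrite subsetEset /A.
    apply: subset_itvl; rewrite bnd_simp lerB// lef_pV2 ?posrE//.
    by rewrite ler_nat.
  - by move=> i; exact: measurable_itv.
  - by move=> i; apply/measurable_EFinP; exact: measurable_funTS.
  - by move=> i y _; rewrite lee_fin.
have q0 : 0 <= q^-1 by rewrite invr_ge0 ltW.
have If0 B : (0 <= If B)%E by apply: integral_ge0 => y _; rewrite lee_fin.
have H : (If [set` `]-oo, z[%R] <= l `^ q^-1)%E.
  apply: (cvge_to_le cv); apply: nearW => k.
  have yz : z - k.+1%:R^-1 < z by rewrite ltrBlDr ltrDl invr_gt0.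
  have := gt0_ler_poweR q0 _ _ (below _ yz).
  rewrite -poweRrM mulfV ?gt_eqF// poweRe1//; apply; rewrite in_itv/= leey andbT//.
  exact: poweR_ge0.
have := gt0_ler_poweR (ltW q_gt0) _ _ H.
rewrite -poweRrM mulVf ?gt_eqF// poweRe1//; apply; rewrite in_itv/= leey andbT//.
exact: poweR_ge0.
Qed.

(** A bad point lies to the right of a mesh point of infinite mass, whose tail is
[nut]-null because the power of [+oo] is 0. *)
Lemma good_ae : nut.-negligible (~` good).
Proof.
pose B n i : set (measurableTypeR R) :=
  if (distr nu (mesh n i) < +oo)%E then set0 else [set` `]mesh n i, +oo[%R].
suff : nut.-negligible (\bigcup_n \bigcup_i B n i).
  apply: negligibleS.
  move=> z /= /existsNP[y] /not_implyP[yz /negP Sy].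
  near \oo => n.
  have [i _ /andP[yi iz]] : exists2 i, (i < mesh_size n)%N & y <= mesh n i < z.
    by near: n; exact: mesh_dense.
  exists n => //; exists i => //; rewrite /B ifF/= ?in_itv/= ?iz//.
  apply/negbTE; apply: contra Sy => Si; apply: le_lt_trans Si.
  exact: distr_le.
apply: negligible_bigcup => n; apply: negligible_bigcup => i.
rewrite /B; case: ifPn => [_|Si]; first exact: negligible_set0.
apply/negligibleP; first exact: measurable_itv.
apply: (etrans (hnut _)); rewrite /neg_power.
have -> : distr nu (mesh n i) = +oo%E by apply/eqP; rewrite -leye_eq leNgt.
by rewrite poweRyr ?invey// gt_eqF.
Unshelve. all: by end_near. Qed.

Lemma bliss_power :
  (\int[nut]_x ((\int[nu]_(y in `]-oo, x[) (f y)%:E) `^ q) <= C%:E)%E.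
Proof.
have If0 B : (0 <= If B)%E by apply: integral_ge0 => y _; rewrite lee_fin.
have mF : measurable_fun [set: measurableTypeR R]
    (fun x : measurableTypeR R => ((If [set` `]-oo, x[%R]) `^ q)%E).
  apply: nondecreasing_emeasurable => x y xy.
  apply: gt0_ler_poweR; rewrite ?(ltW q_gt0) ?in_itv/= ?leey ?If0//.
  apply: ge0_subset_integral => //; try exact: measurable_itv.
  - by apply/measurable_EFinP; exact: measurable_funTS.
  - by move=> t _; rewrite lee_fin.
  - by apply: subset_itvl; rewrite bnd_simp.
have psi0 n y : (0 <= psi n y)%E by exact: (grid_fun_ge0 (mesh_ndecr n)).
have mpsi n : measurable_fun setT (psi n) by exact: measurable_grid_fun.
apply: (@le_trans _ _ (\int[nut]_x limn_einf (fun n => psi n x))%E).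
  apply: ae_ge0_le_integral => //.
  - by move=> x _; exact: poweR_ge0.
  - by move=> x _; apply: limn_einf_ge; apply: nearW.
  - have -> : (fun x => limn_einf (fun n => psi n x)) =
        (fun x => - limn_esup (fun n => - psi n x))%E by [].
    apply: measurableT_comp => //; apply: measurable_fun_limn_esup => n.
    exact: measurableT_comp.
  - apply: (negligibleS _ good_ae) => z /= H gz; apply: H => _.
    exact: integral_le_liminf.
have := @fatou _ _ R nut setT measurableT psi mpsi (fun n x _ => psi0 n x).
move=> /le_trans; apply.
rewrite limn_einf_lim; apply: lime_le; first exact: is_cvg_einfs.
apply: nearW => n; apply: (@le_trans _ _ (\int[nut]_x psi n x)%E).
  by apply: ereal_inf_lbound; exists n => //=.
exact: (integral_grid_fun (mesh_ndecr n)).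
Qed.

End transfer.

Unset Implicit Arguments.
Local Open Scope ereal_scope.

Theorem lemma2p2 (R : realType) (p q : R) (hp : (1 < p)%R) (hpq : (p <= q)%R)
    (nu nut : {measure set (measurableTypeR R) -> \bar R})
    (hnut : forall x : R,
       nut [set` `]x, +oo[%R] = neg_power (distr nu x) (q / conj_exp p)%R)
    (hS : distr nu x @[x --> +oo%R] --> +oo)
    (f : measurableTypeR R -> R) (mf : measurable_fun setT f)
    (f0 : forall y, (0 <= f y)%R) :
  (\int[nut]_x ((\int[nu]_(y in `]-oo, x[) (f y)%:E) `^ q)) `^ (q^-1)
  <= (kconst q p)%:E * (\int[nu]_y ((f y) `^ p)%:E) `^ (p^-1).
Proof.
have p0 : (0 < p)%R by exact: lt_trans hp.
have q0 : (0 < q)%R by exact: lt_le_trans hpq.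
have k0 := kconst_gt0 hp hpq.
have Ip0 : 0 <= \int[nu]_y ((f y) `^ p)%:E.
  by apply: integral_ge0 => y _; rewrite lee_fin powR_ge0.
have [IpT|] := Order.TotalTheory.ltP (\int[nu]_y ((f y) `^ p)%:E) +oo; last first.
  rewrite leye_eq => /eqP ->.
  by rewrite poweRyr ?invr_neq0 ?gt_eqF// gt0_muley ?lte_fin// leey.
have B := bliss_power hp hpq hnut mf f0 IpT.
have qV0 : (0 <= q^-1)%R by rewrite invr_ge0 ltW.
have I0 : 0 <= \int[nut]_x ((\int[nu]_(y in `]-oo, x[) (f y)%:E) `^ q).
  by apply: integral_ge0 => x _; exact: poweR_ge0.
have := gt0_ler_poweR qV0 _ _ B; rewrite !in_itv/= !leey !andbT.
move=> /(_ I0) H; apply: le_trans (H _) _.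
  by rewrite lee_fin mulr_ge0 ?powR_ge0.
rewrite powRM ?powR_ge0// -!powRrM mulfV ?gt_eqF//.
rewrite powRr1 ?(ltW k0)// mulrAC mulfV ?gt_eqF// mul1r.
rewrite EFinM -poweR_EFin fineK// ge0_fin_numE//.
Qed.
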